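(* The class of minimally unsatisfiable generalised clause-sets $F$ with $\delta(F)=1$ has the following two characterisations: (i) a generalised clause-set $F$ is minimally unsatisfiable with $\delta(F)=1$ if and only if $F$ can be reduced to the clause-set $\{\bot\}$ (containing only the empty clause) by applying non-degenerated singular DP-reduction as long as possible, in any order; (ii) the minimally unsatisfiable generalised clause-sets of deficiency $1$ are exactly the clause-sets $F(T,r,v,\varepsilon)$ for deficiency-1 tree representations $(T,r,v,\varepsilon)$, together with all clause-sets derived from such clause-sets by literal elimination.
   Context: Each variable $v$ has a finite non-empty domain $D_v$; a literal is a pair $(v,\varepsilon)$, $\varepsilon\in D_v$, meaning ''$v\ne\varepsilon$''; a clause is a finite set of literals with no two distinct literals on the same variable; a clause-set is a finite set of clauses; minimally unsatisfiable = unsatisfiable with all proper subsets satisfiable. $c(F)=|F|$, $\mathrm{rd}(F)=\sum_{v\in\mathrm{var}(F)}(|D_v|-1)$, $\delta(F)=c(F)-\mathrm{rd}(F)$. $\#_{(v,\varepsilon)}(F)$ = number of clauses containing $(v,\varepsilon)$; $v$ is pure for $F$ if $\#_{(v,\varepsilon)}(F)=0$ for some $\varepsilon\in D_v$. DP-reduction: a resolvent on $v$ of clauses $C_1,\dots,C_{|D_v|}$ of $F$ in which every value of $D_v$ occurs in some literal $(v,\varepsilon)\in C_i$ is $\bigcup_i\{x\in C_i:\mathrm{var}(x)\ne v\}$, provided this is a clause (no clash); $\mathrm{DP}_v(F)$ = clauses of $F$ not containing $v$ plus all resolvents on $v$. $v$ is singular for $F$ if there is $\varepsilon\in D_v$ with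 $\#_{(v,\varepsilon')}(F)=1$ for all $\varepsilon'\ne\varepsilon$ and $\#_{(v,\varepsilon)}(F)\ge1$. $v$ is a non-degenerated DP-variable if $v$ is not pure and $c(\mathrm{DP}_v(F))=c(F)-\sum_{\varepsilon}\#_{(v,\varepsilon)}(F)+\prod_\varepsilon\#_{(v,\varepsilon)}(F)$. Non-degenerated singular DP-reduction is $F\mapsto\mathrm{DP}_v(F)$ for $v$ singular and non-degenerated. A deficiency-1 tree representation $(T,r,v,\varepsilon)$ is a finite rooted tree $(T,r)$ (edges directed away from $r$) in which each inner node $w$ is labelled by a variable $v(w)$, distinct inner nodes getting distinct variables, and each edge leaving $w$ is labelled by a value $\varepsilon(e)\in D_{v(w)}$ such that the labels of the edges leaving $w$ are in bijection with $D_{v(w)}$. For a node $w$ with root path $w_0=r,e_1,w_1,\dots,e_m,w_m=w$ let $C_w=\{(v(w_i),\varepsilon(e_{i+1})):0\le i<m\}$; $F(T,r,v,\varepsilon)$ is the set of $C_w$ over all leaves $w$. A clause-set $F'$ is obtained from such a clause-set by literal elimination if it results by removing some (at least one) literal occurrences without ever creating a pure variable. *)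

(* Defs.v *)
From Stdlib Require Import Relation_Definitions Relation_Operators.
From HB Require Import structures.
From mathcomp Require Import all_boot all_order all_algebra finmap.

Set Implicit Arguments.
Unset Strict Implicit.
Unset Printing Implicit Defensive.

Import GRing.Theory.
Local Open Scope fset_scope.

Section GeneralisedClauseSets.
Variables (V : choiceType) (D : V -> finType).

(* The literal (v, e), written [lit e], means "v <> e". *)
Definition literal : choiceType := {v : V & D v}.
Definition lit (v : V) (e : D v) : literal := Tagged D e.

Definition is_clause (C : {fset literal}) : Prop :=
  {in C &, forall x y : literal, tag x = tag y -> x = y}.

Definition is_clauseb (C : {fset literal}) : bool :=
  [forall x : C, forall y : C, (tag (val x) == tag (val y)) ==> (x == y)].

Lemma is_clauseP C : reflect (is_clause C) (is_clauseb C).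
Proof.
apply: (iffP forallP) => [H x y xC yC txy | H x].
  have /forallP/(_ [` yC])/implyP := H [` xC].
  by rewrite /= txy => /(_ (eqxx _))/eqP/(congr1 val).
apply/forallP => y; apply/implyP => /eqP txy.
by apply/eqP/val_inj/H => //; apply: fsvalP.
Qed.

(* The notions below make sense for arbitrary finite sets of finite sets of
   literals; [clause_set] singles out the genuine clause-sets. *)
Definition pre_clause_set : Type := {fset {fset literal}}.
Implicit Types (F G : pre_clause_set).

Definition clause_set F : Prop := forall C, C \in F -> is_clause C.

Definition satisfies (phi : forall v, D v) (C : {fset literal}) : Prop :=
  exists2 x, x \in C & phi (tag x) != tagged x.

Definition satisfiable F : Prop :=
  exists phi : forall v, D v, forall C, C \in F -> satisfies phi C.

Definition minimally_unsatisfiable F : Prop :=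
  ~ satisfiable F /\ (forall G, G `<` F -> satisfiable G).

Definition clause_var (C : {fset literal}) : {fset V} := [fset tag x | x in C].
Definition var F : {fset V} := \bigcup_(C <- F) clause_var C.

Definition rd F : nat := \sum_(v <- var F) (#|D v| - 1)%N.

Definition deficiency F : int := ((#|` F|)%:Z - (rd F)%:Z)%R.

Definition MU1 F : Prop := minimally_unsatisfiable F /\ deficiency F = 1%R.

Definition occ F (v : V) (e : D v) : nat := #|` [fset C in F | lit e \in C]|.

Definition pure F (v : V) : Prop := exists e : D v, occ F e = 0.

(* The parent clauses are indexed by the values of v: P e contains (v, e). *)
Definition resolvent F (v : V) (P : {ffun D v -> F}) : {fset literal} :=
  \bigcup_(e <- enum (D v)) [fset x in val (P e) | tag x != v].

Definition resolvents F (v : V) : pre_clause_set :=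
  [fset resolvent P | P : {ffun D v -> F} &
     [forall e, lit e \in val (P e)] && is_clauseb (resolvent P)].

Definition DP (v : V) F : pre_clause_set :=
  [fset C in F | v \notin clause_var C] `|` resolvents F v.

Definition singular F (v : V) : Prop :=
  exists e : D v,
    (forall e' : D v, e' <> e -> occ F e' = 1) /\ (1 <= occ F e)%N.

(* The cardinality equation is read in int, avoiding truncated subtraction. *)
Definition nondegenerated F (v : V) : Prop :=
  ~ pure F v /\
  ((#|` DP v F|)%:Z = (#|` F|)%:Z - (\sum_(e : D v) occ F e)%:Z
                      + (\prod_(e : D v) occ F e)%:Z)%R.

Definition sDP_step F G : Prop :=
  exists v : V, [/\ singular F v, nondegenerated F v & G = DP v F].

Definition sDP_reduces : pre_clause_set -> pre_clause_set -> Prop :=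
  clos_refl_trans _ sDP_step.

Definition sDP_irreducible F : Prop := forall G, ~ sDP_step F G.

(* G is the end result of some reduction of F carried on as long as possible. *)
Definition sDP_result F G : Prop := sDP_reduces F G /\ sDP_irreducible G.

Definition bot_set : pre_clause_set := [fset fset0].

(* Finite rooted trees whose inner nodes carry a variable v and have exactly one
   outgoing edge for each value of v; [ch e] hangs below the edge labelled e. *)
Inductive tree : Type :=
| Leaf
| Node (v : V) (ch : D v -> tree).

Fixpoint inner_vars (t : tree) : seq V :=
  match t with
  | Leaf => [::]
  | Node v ch => v :: flatten [seq inner_vars (ch e) | e <- enum (D v)]
  end.

Definition tree_representation (t : tree) : Prop := uniq (inner_vars t).

(* The leaves, each given by the labels (v(w_i), eps(e_{i+1})) read along the
   path from the root. *)
Fixpoint leaf_paths (t : tree) : seq (seq literal) :=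
  match t with
  | Leaf => [:: [::]]
  | Node v ch => [seq lit e :: p | e <- enum (D v), p <- leaf_paths (ch e)]
  end.

Definition tree_clause_set (t : tree) : pre_clause_set :=
  [fset [fset x in p] | p : seq literal in leaf_paths t].

(* Removes one literal occurrence without creating a pure variable. *)
Definition elimination_step F G : Prop :=
  exists (C : {fset literal}) (x : literal),
    [/\ C \in F, x \in C, G = (C `\ x) |` (F `\ C)
      & forall v, ~ pure F v -> ~ pure G v].

Definition literal_elimination : pre_clause_set -> pre_clause_set -> Prop :=
  clos_trans _ elimination_step.

End GeneralisedClauseSets.

Arguments bot_set {V D}.
Arguments Leaf {V D}.

(* Main.v *)
(* Satisfiability is relativised to a finite set [W] of variables: literals on
   other variables are ignored, so that setting or splitting on a variable becomes
   the removal of that variable from [W].  Branching on [v] covers a minimally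
   unsatisfiable [F] by minimally unsatisfiable sets [S e], one for each value of
   [v], and supermodularity of the deficiency yields inductively that every proper
   subset of [F] has smaller deficiency than [F].

   In deficiency 1 all inequalities are equalities.  If the sets [S e] are pairwise
   disjoint, [v] is the root of a tree for [F].  Otherwise the intersection [X] of
   two of them is nonempty and of deficiency 0; collapsing the complement of [X] to
   one clause gives a smaller set of deficiency 1, whose root also is a root of [F].
   A deepest inner node of the resulting tree is a variable each of whose values
   occurs exactly once, and DP-reduction on it is singular and nondegenerate.

   Nondegeneracy says that all resolvents exist, are distinct, and differ from the
   clauses without [v]; hence a singular nondegenerate reduction preserves
   deficiency and minimality in both directions. *)

Require Import Defs.
From Stdlib Require Import Classical.
From mathcomp Require Import all_boot all_order all_algebra finmap zify.

Set Implicit Arguments.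
Unset Strict Implicit.
Unset Printing Implicit Defensive.

Local Open Scope fset_scope.

(** * Satisfiability relative to a set of variables *)

Section RelativeSatisfiability.
Variables (V : choiceType) (D : V -> finType).
Variable hD : forall v : V, (0 < #|D v|)%N.
Implicit Types (F G H S T X : pre_clause_set D) (W U A B : {fset V}).
Implicit Types (C : {fset literal D}) (phi : forall v, D v) (t : tree D).

Definition value0 v : D v := enum_val (Ordinal (hD v)).

Definition satb W phi C : bool :=
  has (fun x : literal D => (tag x \in W) && (phi (tag x) != tagged x)) C.

Lemma satbP W phi C :
  reflect (exists x : literal D, [/\ x \in C, tag x \in W & phi (tag x) != tagged x])
          (satb W phi C).
Proof.
apply: (iffP hasP) => [[x xC /andP[xW xn]]|[x [xC xW xn]]]; exists x => //.
by rewrite xW.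
Qed.

Definition sat W F : Prop := exists phi, forall C, C \in F -> satb W phi C.

Definition MU W F : Prop := ~ sat W F /\ forall G, G `<` F -> sat W G.

Definition weight A : nat := \sum_(v <- A) (#|D v| - 1).
(** The relative counterpart of [rd]: the number of clauses minus [rank W F] is the deficiency of
    [F] when only the variables in [W] count. *)
Definition rank W F : nat := weight (var F `&` W).

Lemma satb_eq W U phi psi C :
  (forall x : literal D, x \in C -> tag x \in W ->
     tag x \in U /\ phi (tag x) = psi (tag x)) ->
  satb W phi C -> satb U psi C.
Proof.
move=> h /satbP[x [xC xW xn]]; have [xU e] := h x xC xW.
by apply/satbP; exists x; rewrite -e.
Qed.

Lemma sat_sub W F G : G `<=` F -> sat W F -> sat W G.
Proof. by move=> /fsubsetP sGF [phi h]; exists phi => C /sGF/h. Qed.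

Lemma MU_unsat W F phi : MU W F -> exists2 C, C \in F & ~~ satb W phi C.
Proof.
move=> [nsF _]; apply/hasP; apply/negPn/negP => /hasPn h.
by apply: nsF; exists phi => C /h /negPn.
Qed.

Lemma MU_neq0 W F : MU W F -> F != fset0.
Proof.
move=> muF; have [C CF _] := MU_unsat value0 muF.
by apply/fset0Pn; exists C.
Qed.

Lemma exists_MU W F : ~ sat W F -> exists2 G, G `<=` F & MU W G.
Proof.
elim/finSet_rect: F => F IH nsF.
have [muF|nmuF] := classic (MU W F); first by exists F.
have [G nh] : exists G, ~ (G `<` F -> sat W G).
  by apply: not_all_ex_not => h; apply: nmuF.
have [GF nsG] := imply_to_and _ _ nh.
have [H HG muH] := IH G GF nsG.
by exists H => //; apply: (fsubset_trans HG); apply: fproper_sub.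
Qed.

Lemma varP F (v : V) :
  reflect (exists C, exists x : literal D, [/\ C \in F, x \in C & tag x = v]) (v \in var F).
Proof.
apply: (iffP (bigfcupP _ _ _ _)) => [[C]|[C [x [CF xC <-]]]].
  by rewrite andbT => CF /imfsetP[x /= xC ->]; exists C, x.
by exists C; rewrite ?CF //; apply/imfsetP; exists x.
Qed.

Lemma mem_var F C (x : literal D) : C \in F -> x \in C -> tag x \in var F.
Proof. by move=> CF xC; apply/varP; exists C, x. Qed.

Lemma varU F G : var (F `|` G) = var F `|` var G.
Proof.
apply/fsetP => v; rewrite inE; apply/varP/orP.
  by move=> [C [x [/fsetUP[CF|CF] xC <-]]]; [left|right]; apply: mem_var xC.
by move=> [] /varP[C [x [CF xC <-]]]; exists C, x; rewrite inE CF ?orbT.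
Qed.

Lemma varS F G : F `<=` G -> var F `<=` var G.
Proof.
move=> /fsubsetP sFG; apply/fsubsetP => v /varP[C [x [CF xC <-]]].
by apply: mem_var xC; apply: sFG.
Qed.

Lemma weightUI A B : (weight (A `|` B) + weight (A `&` B) = weight A + weight B)%N.
Proof.
rewrite /weight (big_fsetID _ (mem A)) (big_fsetID _ (mem A) B) /=.
rewrite [X in (X + _ + _)%N](_ : _ = \sum_(v <- A) (#|D v| - 1))%N; last first.
  by apply: eq_fbigl => v; rewrite !inE /=; case: (v \in A); rewrite ?andbF.
rewrite [X in (_ + (X + _))%N](_ : _ = \sum_(v <- A `&` B) (#|D v| - 1))%N; last first.
  by apply: eq_fbigl => v; rewrite !inE /= andbC.
rewrite -!addnA; congr (_ + _)%N; rewrite addnC; congr (_ + _)%N.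
by apply: eq_fbigl => v; rewrite !inE /=; case: (v \in A); rewrite ?andbF ?andbT.
Qed.

Lemma weight_le A B : A `<=` B -> (weight A <= weight B)%N.
Proof.
move=> /fsetIidPl sAB; rewrite /weight [X in (_ <= X)%N](big_fsetID _ (mem A)) /=.
suff -> : (\sum_(v <- A) (#|D v| - 1) = \sum_(v <- [fset x in B | x \in A]) (#|D v| - 1))%N.
  exact: leq_addr.
by apply: eq_fbigl => v; rewrite -[in LHS]sAB !inE /= andbC.
Qed.

Lemma weight1 v : weight [fset v] = (#|D v| - 1)%N.
Proof. by rewrite /weight big_seq_fset1. Qed.

Lemma weight0 : weight fset0 = 0%N.
Proof. by rewrite /weight big_seq_fset0. Qed.

Lemma rankU W S T :
  (rank W (S `|` T) + weight (var S `&` var T `&` W) = rank W S + rank W T)%N.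
Proof. by rewrite /rank varU fsetIUl fsetIIl weightUI. Qed.

(** Equality can fail, since a variable shared by [S] and [T] need not occur in a shared clause.
    Together with [rankU] this makes the relative deficiency supermodular. *)
Lemma rankI W S T : (rank W (S `&` T) <= weight (var S `&` var T `&` W))%N.
Proof.
apply/weight_le/fsetSI/fsubsetP => v /varP[C [x [/fsetIP[CS CT] xC <-]]].
by rewrite inE !(mem_var _ xC).
Qed.

Lemma rank_mem W F (v : V) : v \in W -> v \in var F ->
  rank W F = (rank (W `\ v) F + (#|D v| - 1))%N.
Proof.
move=> vW vF; rewrite /rank -weight1 -weightUI.
rewrite (_ : _ `&` [fset v] = fset0) ?weight0 ?addn0; last first.
  by apply/fsetP => u; rewrite !inE; case: eqP; rewrite ?andbF.
congr weight; apply/fsetP => u; rewrite !inE; case: (eqVneq u v) => [->|] /=.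
  by rewrite vW vF orbT.
by rewrite orbF.
Qed.

Lemma rank_notin W F (v : V) : v \notin var F -> rank (W `\ v) F = rank W F.
Proof.
move=> vF; congr weight; apply/fsetP => u; rewrite !inE.
by case: (eqVneq u v) => [->|//]; rewrite (negPf vF).
Qed.

(** If the union were a proper subset of [F], some [phi] would satisfy it. In [S (phi v)] the
    literals on [v] all carry the value [phi v] and are false, so [phi] would satisfy [S (phi v)]
    without using [v]. *)
Lemma split_cover W F (v : V) (S : D v -> pre_clause_set D) :
  MU W F -> (forall e, S e `<=` F) -> (forall e, ~ sat (W `\ v) (S e)) ->
  (forall e C e', C \in S e -> lit e' \in C -> e' = e) ->
  \bigcup_(e <- enum (D v)) S e = F.
Proof.
move=> [_ muF] SF nsS litS.
have /eqVfproper[//|/muF [phi h]] : \bigcup_(e <- enum (D v)) S e `<=` F.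
  by apply/bigfcupsP => e _ _.
case: (nsS (phi v)); exists phi => C CS.
have /satbP[x [xC xW xn]] : satb W phi C.
  by apply: h; apply/bigfcupP; exists (phi v); rewrite ?mem_enum.
apply/satbP; exists x; split => //; rewrite !inE xW andbT.
apply/eqP => txv; case: x xC xn txv {xW} => u e /= xC xn uv.
by case: v / uv e xn xC S litS {SF nsS h CS} (CS) => e xn xC S litS CS;
   move: xn; rewrite (litS _ _ _ CS xC) eqxx.
Qed.

Lemma MU_split W F (v : V) : MU W F -> v \in W -> v \in var F ->
  exists S : D v -> pre_clause_set D,
    [/\ forall e, S e `<=` F, forall e, MU (W `\ v) (S e),
        forall e C e', C \in S e -> lit e' \in C -> e' = e,
        forall e, exists2 C, C \in S e & lit e \in C
      & \bigcup_(e <- enum (D v)) S e = F].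
Proof.
move=> muF vW vF.
(* These clauses are the ones not made true by setting [v] to [e]; they stay unsatisfiable over the
   remaining variables. *)
pose R e := [fset C in F | [forall e' : D v, (lit e' \in C) ==> (e' == e)]].
have nsR e : ~ sat (W `\ v) (R e).
  move=> [phi h]; have [C CF /negP[]] := MU_unsat (dfwith phi e) muF.
  have [CR|] := boolP (C \in R e).
    apply: satb_eq (h C CR) => x _; rewrite !inE => /andP[xv xW]; split => //.
    by rewrite dfwith_out // eq_sym.
  rewrite !inE CF /= => /forallPn[e']; rewrite negb_imply => /andP[e'C ee'].
  by apply/satbP; exists (lit e'); rewrite /= dfwith_in eq_sym.
have /fin_all_exists2[S SR muS] := fun e => exists_MU (nsR e).
have litS e C e' : C \in S e -> lit e' \in C -> e' = e.
  by move/(fsubsetP (SR e)); rewrite !inE => /andP[_ /forallP/(_ e')/implyP h] /h/eqP.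
have SF e : S e `<=` F.
  by apply: (fsubset_trans (SR e)); apply/fsubsetP => C; rewrite !inE => /andP[].
have SU : \bigcup_(e <- enum (D v)) S e = F.
  by apply: split_cover muF _ _ litS => // e; case: (muS e).
(* If [lit e] is missing from [S e], then [S e] does not mention [v], is unsatisfiable over [W] as
   well and equals [F]; but [v] occurs in [F]. *)
exists S; split => // e; apply: NNPP => nC.
have litN C x : C \in S e -> x \in C -> tag x != v.
  move=> CS xC; apply/eqP => xv; apply: nC; exists C => //.
  case: x xC xv => u e' /= xC uv; move: e' xC; rewrite uv => e' xC.
  by rewrite -(litS _ _ _ CS xC).
have SeF : S e = F.
  have /eqVfproper[//|/(proj2 muF) [phi h]] := SF e.
  case: (proj1 (muS e)); exists phi => C CS; apply: satb_eq (h C CS) => x xC xW.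
  by rewrite !inE xW (litN _ _ CS xC).
have /varP[C [x [CF xC xv]]] := vF.
by have := litN C x; rewrite SeF xv eqxx => /(_ CF xC).
Qed.

(** * Deficiency of minimally unsatisfiable sets *)

(* [lia] misses that two cardinals or ranks agree when their arguments are only
   convertible (canonical instances of [{fset _}]). *)
Local Ltac fset_lia :=
  repeat match goal with
    |- context [rank ?W ?F] => let r := fresh "r" in set r := rank W F; clearbody r
  end;
  repeat match goal with
    |- context [size (enum_fset ?F)] =>
      let c := fresh "c" in set c := size (enum_fset F); clearbody c
  end; lia.

(** Strict increase of the relative deficiency from proper subsets to [T], with the terms moved
    across to avoid subtraction. *)
Definition surplus W T : Prop :=
  forall H, H `<` T -> (#|` H| + rank W T + 1 <= #|` T| + rank W H)%N.

(** By supermodularity, joining [T] to [S] changes the deficiency by at least that of [T] minus that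
    of the intersection, a proper subset of [T]. *)
Lemma surplus_join W S T : surplus W T -> ~~ (T `<=` S) ->
  (#|` S| + rank W (S `|` T) + 1 <= #|` S `|` T| + rank W S)%N.
Proof.
move=> spT nTS; have := spT _ (fproperIr nTS).
by have := cardfsUI S T; have := rankU W S T; have := rankI W S T; fset_lia.
Qed.

Lemma surplus_join_weak W S T : surplus W T ->
  (#|` S| + rank W (S `|` T) <= #|` S `|` T| + rank W S)%N.
Proof.
move=> spT; have [/fsetUidPl ->|/(surplus_join spT)] := boolP (T `<=` S); first by [].
fset_lia.
Qed.

Lemma surplus_joins W (I : eqType) (S : I -> pre_clause_set D) (l : seq I) H :
  (forall i, surplus W (S i)) ->
  (#|` H| + rank W (H `|` \bigcup_(i <- l) S i)
     <= #|` H `|` \bigcup_(i <- l) S i| + rank W H)%N.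
Proof.
move=> spS; elim: l H => [|i l IH] H; first by rewrite big_nil fsetU0.
rewrite big_cons fsetUA; have := IH (H `|` S i).
by have := surplus_join_weak H (spS i); fset_lia.
Qed.

(** A clause of [S e] with [lit e] lies neither in [H] nor in any other [S e']. So no [S e] is
    absorbed before its turn, and each join gains one. *)
Lemma surplus_joins_fresh W (v : V) (S : D v -> pre_clause_set D) (l : seq (D v)) H :
  (forall e, surplus W (S e)) ->
  (forall e C e', C \in S e -> lit e' \in C -> e' = e) ->
  (forall e, exists2 C, C \in S e & lit e \in C) ->
  uniq l -> (forall e C, e \in l -> C \in H -> lit e \notin C) ->
  (#|` H| + rank W (H `|` \bigcup_(e <- l) S e) + size l
     <= #|` H `|` \bigcup_(e <- l) S e| + rank W H)%N.
Proof.
move=> spS litS exS; elim: l H => [|e l IH] H /=; first by rewrite big_nil fsetU0 addn0.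
move=> /andP[el ul] nH; rewrite big_cons fsetUA.
have /(surplus_join (spS e)) : ~~ (S e `<=` H).
  have [C CS eC] := exS e; apply: contraL eC => /fsubsetP/(_ C CS).
  by apply: nH; rewrite inE eqxx.
suff h : forall e' C, e' \in l -> C \in H `|` S e -> lit e' \notin C.
  by have := IH _ ul h; fset_lia.
move=> e' C e'l /fsetUP[CH|CS]; first by apply: nH; rewrite // inE e'l orbT.
by apply: contraNN el => /(litS _ _ _ CS) <-.
Qed.

(* Branching on a variable [v] of [F] splits [F] into the sets [S e], each
   minimally unsatisfiable over fewer variables; joining them one after the other
   gains at least one clause over the rank for every [S e] not yet absorbed. *)
Theorem MU_surplus W F : MU W F -> surplus W F.
Proof.
have [n] := ubnP #|` W|; elim: n W F => // n IH W F leWn muF H HF.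
have [/eqP W0|/fset0Pn[v /fsetIP[vF vW]]] := boolP (var F `&` W == fset0).
  rewrite [rank W F](_ : _ = 0%N) ?/rank ?W0 ?weight0 // addn0.
  (* A clause of [H] is satisfied only through a variable in [W], of which there is none here; hence
     [H] is empty. *)
  suff -> : #|` H| = 0%N by have := fproper_ltn_card HF; fset_lia.
  apply/eqP; rewrite cardfs_eq0; apply/fset0Pn => -[C CH].
  have [phi /(_ C CH)/satbP[x [xC xW _]]] := proj2 muF H HF.
  have: tag x \in var F `&` W.
    by rewrite inE xW andbT; apply: mem_var xC; apply: (fsubsetP (fproper_sub HF)).
  by rewrite W0.
have [S [SF muS litS exS SU]] := MU_split muF vW vF.
have spS e : surplus (W `\ v) (S e).
  by apply: IH (muS e); move: leWn; rewrite (cardfsD1 v) vW; fset_lia.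
have HUF : H `|` \bigcup_(e <- enum (D v)) S e = F.
  by rewrite SU; apply/fsetUidPr/fproper_sub.
(* If [v] occurs in [H], dropping [v] lowers both ranks equally, and one [S e] not inside [H] gives
   the gain. Otherwise only the rank of [F] drops, by [#|D v| - 1], while the fresh joins gain
   [#|D v|]. *)
have := rank_mem vW vF; have [vH|vH] := boolP (v \in var H).
  have := rank_mem vW vH; have [e eH] : exists e, ~~ (S e `<=` H).
    apply/existsP; rewrite -negb_forall; apply/negP => /forallP SH.
    move: HF; rewrite fproperE => /andP[_ /negP[]]; rewrite -SU.
    by apply/bigfcupsP => e _ _.
  have := surplus_joins (enum (D v)) (H `|` S e) spS.
  rewrite fsetUAC HUF (fsetUidPl _ _ (SF e)).
  by have := surplus_join (spS e) eH; fset_lia.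
have := rank_notin W vH.
have: forall e C, e \in enum (D v) -> C \in H -> lit e \notin C.
  by move=> e C _ CH; apply: contraNN vH => /(mem_var CH).
move/(surplus_joins_fresh spS litS exS (enum_uniq _)).
by rewrite HUF -cardE; move: (hD v); set d := #|_|; fset_lia.
Qed.

Lemma rank0 W : rank W fset0 = 0%N.
Proof.
rewrite /rank (_ : var _ = fset0) ?fset0I ?weight0 //.
by apply/fsetP => v; apply/varP => -[C [x []]].
Qed.

(** The case of the empty subset, whose deficiency is 0. *)
Lemma MU_rank W F : MU W F -> (rank W F + 1 <= #|` F|)%N.
Proof.
move=> muF; have := MU_surplus muF (H := fset0).
by rewrite fproper0 (MU_neq0 muF) rank0 cardfs0 => /(_ isT); fset_lia.
Qed.

Definition tightMU W F : Prop := MU W F /\ #|` F| = (rank W F + 1)%N.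

(** A variable with at least two values has positive weight, so one missing from [A] would make [B]
    heavier. *)
Lemma weight_eq_sub A B : A `<=` B -> (weight B <= weight A)%N ->
  (forall u, u \in B -> (1 < #|D u|)%N) -> B `<=` A.
Proof.
move=> sAB leBA D2; apply/fsubsetP => u uB; apply/negPn/negP => uA.
have := weightUI A [fset u]; rewrite weight1.
have -> : A `&` [fset u] = fset0.
  by apply/fsetP => w; rewrite !inE; case: eqP => [->|]; rewrite ?andbF // (negPf uA).
rewrite weight0.
have : (weight (A `|` [fset u]) <= weight B)%N.
  by apply: weight_le; rewrite fsubUset sAB fsub1set.
by have := D2 u uB; lia.
Qed.

Lemma bigcup_rem (I : eqType) (S : I -> pre_clause_set D) (i : I) (l : seq I) :
  i \in l -> \bigcup_(j <- l) S j = S i `|` \bigcup_(j <- rem i l) S j.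
Proof. by move=> il; rewrite (perm_big _ (perm_to_rem il)) big_cons. Qed.

(** Relative to [W] without [v], the deficiency of [F] is [#|D v|]. Starting from [S e], the other
    joins gain [#|D v| - 1], which leaves at most 1 for [S e]. Starting from the union of [S e] and
    [S e'] leaves at most 2 for that union; then supermodularity must be an equality and the
    intersection has deficiency 0. *)
Lemma tightMU_split W F (v : V) : tightMU W F -> v \in W -> v \in var F ->
  exists S : D v -> pre_clause_set D,
    [/\ forall e, S e `<=` F, forall e, tightMU (W `\ v) (S e),
        forall e C e', C \in S e -> lit e' \in C -> e' = e,
        \bigcup_(e <- enum (D v)) S e = F
      & forall e e', e != e' ->
          #|` S e `&` S e'| = rank (W `\ v) (S e `&` S e') /\
          (weight (var (S e) `&` var (S e') `&` (W `\ v))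
             <= rank (W `\ v) (S e `&` S e'))%N].
Proof.
move=> [muF cF] vW vF; have [S [SF muS litS exS SU]] := MU_split muF vW vF.
have spS e : surplus (W `\ v) (S e) by apply: MU_surplus.
have sizeD : size (enum (D v)) = #|D v| by rewrite -cardE.
have exN e e' C : e' != e -> C \in S e -> lit e' \notin C.
  by move=> ne CS; apply: contraNN ne => /(litS _ _ _ CS) ->.
have tS e : (#|` S e| <= rank (W `\ v) (S e) + 1)%N.
  have eD : e \in enum (D v) by rewrite mem_enum.
  have ul : uniq (rem e (enum (D v))) by rewrite rem_uniq ?enum_uniq.
  have := surplus_joins_fresh spS litS exS ul (H := S e); rewrite size_rem // sizeD.
  have -> : S e `|` \bigcup_(i <- rem e (enum (D v))) S i = F by rewrite -SU (bigcup_rem S eD).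
  have := rank_mem vW vF; rewrite cF.
  suff h : forall e' C, e' \in rem e (enum (D v)) -> C \in S e -> lit e' \notin C.
    by move=> h1 /(_ h); move: h1 (hD v); set d := #|_|; fset_lia.
  by move=> e' C; rewrite mem_rem_uniq ?enum_uniq // inE => /andP[ee' _]; apply: exN.
exists S; split=> // [e|e e' ee'].
  split=> //; apply/eqP; rewrite eqn_leq tS; exact: MU_rank.
have eD : e \in enum (D v) by rewrite mem_enum.
have e'D : e' \in rem e (enum (D v)).
  by rewrite mem_rem_uniq ?enum_uniq // inE eq_sym ee' mem_enum.
have ul : uniq (rem e' (rem e (enum (D v)))) by rewrite !rem_uniq ?enum_uniq.
have := surplus_joins_fresh spS litS exS ul (H := S e `|` S e').
rewrite !size_rem // sizeD.
have -> : S e `|` S e' `|` \bigcup_(i <- rem e' (rem e (enum (D v)))) S i = F.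
  by rewrite -fsetUA -(bigcup_rem S e'D) -(bigcup_rem S eD).
have := rank_mem vW vF; rewrite cF.
(* The values [e] and [e'] differ, so the truncated length of the list with both removed is really
   [#|D v| - 2]. *)
have D2 : (1 < #|D v|)%N.
  by have := size_rem eD; rewrite sizeD; case: (rem _ _) e'D => //= a l _; case: #|D v| => [|[]].
have := cardfsUI (S e) (S e'); have := rankU (W `\ v) (S e) (S e').
have := rankI (W `\ v) (S e) (S e').
have: (#|` S e `&` S e'| <= rank (W `\ v) (S e `&` S e'))%N.
  have nS : ~~ (S e `<=` S e').
    by have [C CS eC] := exS e; apply: contraL eC => /fsubsetP/(_ C CS); apply: exN.
  by have := spS e _ (fproperIl nS); have := tS e; fset_lia.
have := MU_rank (muS e); have := MU_rank (muS e').
suff h : forall d C, d \in rem e' (rem e (enum (D v))) -> C \in S e `|` S e' -> lit d \notin C.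
  move=> h1 h2 h3 h4 h5 h6 h7 /(_ h); move: h1 h2 h3 h4 h5 h6 h7 D2; set d := #|D v|.
  by fset_lia.
move=> d C; rewrite !mem_rem_uniq ?rem_uniq ?enum_uniq // !inE.
rewrite mem_rem_uniq ?enum_uniq // inE => /andP[de' /andP[de _]].
by case/orP; apply: exN.
Qed.

Definition mix (U : {fset V}) (phi psi : forall v, D v) v : D v :=
  if v \in U then phi v else psi v.

Definition collapsed W F X : {fset literal D} :=
  [fset x in \bigcup_(C <- F `\` X) C | tag x \in var X `&` W].

(* By tightness of [X], every assignment satisfying [X] falsifies all clauses of
   the complement of [X] on the variables of [X]; hence these clauses may be
   collapsed there to a single clause. *)
Lemma collapse W F X : tightMU W F -> X `<` F -> #|` X| = rank W X ->
  tightMU (var X `&` W) (collapsed W F X |` X).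
Proof.
move=> [muF cF] XF cX; set U := var X `&` W; set L := collapsed W F X.
have XsF := fproper_sub XF.
have inU C (x : literal D) : C \in X -> x \in C -> tag x \in W -> tag x \in U.
  by move=> CX xC xW; rewrite inE xW (mem_var CX).
have UW (v : V) : v \in U -> v \in W by rewrite inE => /andP[].
have satUW phi C : C \in X -> satb W phi C -> satb U phi C.
  by move=> CX; apply: satb_eq => x xC xW; split => //; apply: inU xC xW.
have satWU phi C : satb U phi C -> satb W phi C.
  by apply: satb_eq => x _ xU; split => //; apply: UW.
have mixU phi psi C : satb U phi C -> satb W (mix U phi psi) C.
  by apply: satb_eq => x _ xU; rewrite /mix xU UW.
have mixD phi psi C : satb (W `\` U) psi C -> satb W (mix U phi psi) C.
  by apply: satb_eq => x _; rewrite inE => /andP[xU xW]; rewrite /mix (negPf xU).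
have [phi1 sX] := proj2 muF X XF.
(* An assignment satisfying [X] matters only on [U] and could be combined with one satisfying the
   complement outside [U]. *)
have nsY : ~ sat (W `\` U) (F `\` X).
  move=> [psi h]; have [C CF /negP[]] := MU_unsat (mix U phi1 psi) muF.
  have [CX|CX] := boolP (C \in X); first by apply/mixU/satUW/sX.
  by apply/mixD/h; rewrite inE CX.
(* Otherwise a minimally unsatisfiable [Z] inside has deficiency at least 1 over [W] without [U].
   Added to [X], of deficiency 0, it gives a proper subset of [F] of deficiency at least 1, against
   [MU_surplus]. *)
have sYD y : y \in F `\` X -> sat (W `\` U) ((F `\` X) `\ y).
  move=> yY; apply: NNPP => /exists_MU[Z ZY muZ].
  have ZX : X `&` Z = fset0.
    apply/fsetP => C; rewrite inE in_fset0; apply/negbTE/negP => /andP[CX CZ].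
    by have := fsubsetP ZY _ CZ; rewrite !inE CX /= andbF.
  have ZF : X `|` Z `<` F.
    move: yY; rewrite inE fproperE => /andP[yX yF]; apply/andP; split.
      rewrite fsubUset XsF; apply: (fsubset_trans ZY).
      by apply: (fsubset_trans (fsubsetDl _ _)); apply: fsubsetDl.
    apply/fsubsetPn; exists y => //; rewrite inE negb_or yX.
    by apply: contraNN yX => /(fsubsetP ZY); rewrite !inE eqxx.
  have := MU_surplus muF ZF; have := MU_rank muZ.
  have := cardfsUI X Z; rewrite ZX cardfs0 addn0.
  have: (rank W (X `|` Z) <= rank W X + rank (W `\` U) Z)%N.
    rewrite /rank -weightUI (leq_trans _ (leq_addr _ _)) //; apply: weight_le.
    apply/fsubsetP => u; rewrite varU !inE => /andP[+ ->]; rewrite !andbT.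
    by case: (u \in var X); rewrite //= andbT.
  by move: cX cF; fset_lia.
(* If [phi] also satisfied [y] on [U], the rest of the complement could be satisfied outside [U],
   and so all of [F]. *)
have falseY phi y : (forall C, C \in X -> satb W phi C) -> y \in F `\` X -> ~~ satb U phi y.
  move=> sphi yY; apply/negP => sy; have [psi h] := sYD y yY.
  have [C CF /negP[]] := MU_unsat (mix U phi psi) muF.
  have [CX|CX] := boolP (C \in X); first by apply/mixU/satUW/sphi.
  have [->|Cy] := eqVneq C y; first exact: mixU.
  by apply/mixD/h; rewrite !inE Cy CX.
have LP x : x \in L -> exists2 y, y \in F `\` X & x \in y.
  by rewrite !inE /= => /andP[/bigfcupP[y /andP[yY _] xy] _]; exists y.
have falseL phi : (forall C, C \in X -> satb W phi C) -> ~~ satb U phi L.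
  move=> sphi; apply/negP => /satbP[x [/LP[y yY xy] xU xn]].
  by have /negP[] := falseY phi y sphi yY; apply/satbP; exists x.
have LX : L \notin X.
  by apply/negP => LX; have /negP[] := falseL phi1 sX; apply: satUW (sX L LX).
have varL : var (L |` X) `&` U = U.
  apply/fsetP => v; rewrite inE varU inE; case vU: (v \in U); rewrite ?andbF ?andbT //.
  by move: vU; rewrite inE => /andP[-> _]; rewrite orbT.
split; last by rewrite /rank varL cardfsU1 LX cX addnC.
split=> [[phi h]|G GL].
  have /falseL/negP[] : forall C, C \in X -> satb W phi C.
    by move=> C CX; apply/satWU/h; rewrite !inE CX orbT.
  by apply: h; rewrite !inE eqxx.
have [LG|LG] := boolP (L \in G); last first.
  exists phi1 => C CG; have : C \in L |` X by apply: fsubsetP CG; apply: fproper_sub.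
  rewrite !inE => /predU1P[CL|CX]; first by rewrite -CL CG in LG.
  by apply/satUW/sX.
(* [G] contains [L] but misses a clause of [X], so exchanging [L] for the whole complement gives a
   proper subset of [F]. By [nsY] its satisfying assignment makes some clause of the complement true
   on [U], by a literal of [L]. *)
have [phi h] : sat W ((G `&` X) `|` (F `\` X)).
  apply: (proj2 muF); rewrite fproperE; apply/andP; split.
    by rewrite fsubUset fsubsetDl andbT (fsubset_trans (fsubsetIr _ _)).
  move: GL; rewrite fproperE => /andP[_ /fsubsetPn[C]]; rewrite !inE => CL CG.
  have CX : C \in X by move: CL; case/predU1P => // CL; rewrite CL LG in CG.
  apply/fsubsetPn; exists C; first exact: (fsubsetP XsF).
  by rewrite !inE CX (negPf CG).
exists phi => C CG.
have : C \in L |` X by apply: fsubsetP CG; apply: fproper_sub.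
rewrite !inE => /predU1P[->|CX]; last by apply/satUW/h; rewrite // !inE CG CX.
have [y yY ny] : exists2 y, y \in F `\` X & ~~ satb (W `\` U) phi y.
  by apply/hasP; apply/negPn/negP => /hasPn n; apply: nsY; exists phi => C' /n/negPn.
have /satbP[x [xy xW xn]] : satb W phi y by apply: h; rewrite in_fsetU yY orbT.
have xU : tag x \in U.
  apply/negPn/negP => xU; case/negP: ny; apply/satbP; exists x; split => //.
  by rewrite inE xU.
apply/satbP; exists x; split => //; rewrite !inE /=; apply/andP; split; last by rewrite inE in xU.
by apply/bigfcupP; exists y; rewrite ?yY.
Qed.

(** * Roots and tree representations *)

(** [p C] is the branch below [r] in which [C] lies, also when [r] does not occur in [C]. Different
    branches have only [r] in common within [W]. *)
Definition is_root W F (r : V) (p : {fset literal D} -> D r) : Prop :=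
  [/\ r \in W, r \in var F, forall C e, C \in F -> lit e \in C -> p C = e
    & forall C C' x x', C \in F -> C' \in F -> x \in C -> x' \in C' ->
        tag x = tag x' -> tag x \in W -> tag x != r -> p C = p C'].

Lemma exists_root W F : tightMU W F -> var F `&` W != fset0 ->
  exists r (p : {fset literal D} -> D r), is_root W F p.
Proof.
have [n] := ubnP #|` W|; elim: n W F => // n IH W F leWn tF.
case/fset0Pn=> v0 /fsetIP[v0F v0W].
(* A variable with a single value is a root with one branch. Once this case is excluded,
   [weight_eq_sub] applies. *)
have [[v [vF vW Dv]]|nD1] :=
  classic (exists v, [/\ v \in var F, v \in W & (#|D v| <= 1)%N]).
  have uD (a b : D v) : a = b by apply: (fintype_le1P Dv).
  by exists v, (fun=> value0 v); split.
have D2 u : u \in var F -> u \in W -> (1 < #|D u|)%N.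
  by move=> uF uW; rewrite ltnNge; apply/negP => Du; apply: nD1; exists u.
have [S [SF tS litS SU capS]] := tightMU_split tF v0W v0F.
have SP C : C \in F -> exists e, C \in S e.
  by rewrite -SU => /bigfcupP[e _ CS]; exists e.
have capV e e' : e != e' ->
  var (S e) `&` var (S e') `&` (W `\ v0) `<=` var (S e `&` S e') `&` (W `\ v0).
  move=> ee'; have [_ le] := capS e e' ee'; apply: weight_eq_sub => //.
    apply: fsetSI; apply/fsubsetP => u /varP[C [x [/fsetIP[CS CS'] xC <-]]].
    by rewrite inE !(mem_var _ xC).
  move=> u; rewrite !inE => /andP[/andP[uS _] /andP[_ uW]]; apply: D2 uW.
  by apply: fsubsetP uS; apply: varS.
have [[e [e' [ee' X0]]]|disj] :=
    classic (exists e e', e != e' /\ S e `&` S e' != fset0); last first.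
  (* By [capV], a variable shared by two of the sets apart from [v0] occurs in their intersection.
     The intersections being empty, the sets are the branches below [v0]. *)
  have /fin_all_exists : forall C : F, exists e, val C \in S e by move=> C; apply/SP/valP.
  case=> q qP; pose p C := if insub C is Some c then q c else value0 v0.
  have pP C : C \in F -> C \in S (p C).
    by move=> CF; rewrite /p insubT; apply: (qP [` CF]).
  have vX C (x : literal D) : C \in F -> x \in C -> tag x \in W -> tag x != v0 ->
      tag x \in var (S (p C)) `&` (W `\ v0).
    by move=> CF xC xW xv; rewrite !inE xW xv (mem_var _ xC) // pP.
  exists v0, p; split => // [C e CF eC|C C' x x' CF C'F xC xC' xx' xW xv].
    by rewrite (litS _ _ _ (pP C CF) eC).
  apply/eqP/negPn/negP => pCC'.
  have: tag x \in var (S (p C) `&` S (p C')) `&` (W `\ v0).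
    apply: (fsubsetP (capV _ _ pCC')); rewrite !inE xW xv (mem_var (pP _ CF) xC) /=.
    by rewrite xx' (mem_var (pP _ C'F) xC').
  suff -> : S (p C) `&` S (p C') = fset0.
    by rewrite !inE => /andP[/varP[? [? []]]].
  by apply/eqP/negPn/negP => nX; apply: disj; exists (p C), (p C').
(* A literal on [v0] in [X] would carry both values [e] and [e']. So [v0] is absent from [X], which
   makes [X] proper and [U] smaller than [W]. *)
set X := S e `&` S e' in X0.
have v0X : v0 \notin var X.
  apply/varP => -[C [x [/fsetIP[CS CS'] xC xv]]]; case: x xC xv => u d /= xC uv.
  move: d xC; rewrite uv => d xC; case/eqP: ee'.
  by rewrite -(litS _ _ _ CS xC) -(litS _ _ _ CS' xC).
have cX : #|` X| = rank W X by rewrite (proj1 (capS e e' ee')) rank_notin.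
have XF : X `<` F.
  have XSF : X `<=` S e by apply: fsubsetIl.
  rewrite fproperEneq (fsubset_trans XSF) // andbT; apply: contraNneq v0X => ->.
  exact: v0F.
clearbody X; have tX := collapse tF XF cX.
set U := var X `&` W in tX; set L := collapsed W F X in tX.
have U0 : var (L |` X) `&` U != fset0.
  have : (0 < rank W X)%N by rewrite -cX cardfs_gt0.
  rewrite /rank; have [->|/fset0Pn[u uU] _] := eqVneq (var X `&` W) fset0.
    by rewrite weight0.
  apply/fset0Pn; exists u; rewrite inE uU varU inE.
  by move: uU; rewrite inE => /andP[->]; rewrite orbT.
have UW : (#|` U| < n)%N.
  rewrite -ltnS; apply: leq_trans leWn; rewrite ltnS; apply: fproper_ltn_card.
  rewrite fproperE fsubsetIr; apply/fsubsetPn; exists v0 => //.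
  by rewrite inE (negPf v0X).
have [r [p [rU rX p1 p2]]] := IH U _ UW tX U0.
have inL y x : y \in F -> y \notin X -> x \in y -> tag x \in U -> x \in L.
  move=> yF yX xy xU; rewrite !inE /=; apply/andP; split; last by rewrite inE in xU.
  by apply/bigfcupP; exists y; rewrite // in_fsetD yX yF.
(* All clauses outside [X] follow the branch of [L], which contains their literals on [U]; so the
   root of the collapsed set serves for [F]. *)
clearbody L; pose c C := if C \in X then C else L.
have cP C : c C \in L |` X by rewrite /c; case: ifP => CX; rewrite !inE ?CX ?eqxx ?orbT.
have cL C x : C \in F -> x \in C -> tag x \in U -> x \in c C.
  by move=> CF xC xU; rewrite /c; case: ifPn => // CX; apply: inL xC xU.
have /fsetIP[rX' rW] := rU.
exists r, (p \o c); split => //.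
- by apply: fsubsetP rX'; apply/varS/fproper_sub.
- by move=> C d CF dC /=; apply: p1 (cP C) _; apply: cL.
move=> C C' x x' CF C'F xC xC' xx' xW xr /=; rewrite /c.
have xU C1 x1 : C1 \in X -> x1 \in C1 -> tag x1 = tag x -> tag x \in U.
  by move=> C1X x1C e1; rewrite inE xW andbT -e1; apply: mem_var x1C.
case: ifPn => CX; case: ifPn => C'X //.
- have xU' := xU _ _ CX xC erefl.
  by apply: (p2 C C' x x') => //; rewrite ?inE ?CX ?C'X ?orbT.
- have xU' := xU _ _ CX xC erefl.
  apply: (p2 C L x x') => //; rewrite ?inE ?CX ?eqxx ?orbT //.
  by apply: inL xC' _; rewrite -?xx'.
have xU' := xU _ _ C'X xC' (esym xx').
apply: (p2 L C' x x') => //; rewrite ?inE ?C'X ?eqxx ?orbT //.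
by apply: inL xC _.
Qed.

Lemma MU_occurs W F (v : V) (e : D v) : MU W F -> v \in W -> v \in var F ->
  exists2 C, C \in F & lit e \in C.
Proof.
move=> muF vW vF; have [S [SF _ _ /(_ e)[C CS eC] _]] := MU_split muF vW vF.
by exists C => //; apply: fsubsetP CS.
Qed.

(** Otherwise [G] and its complement are both proper and satisfiable; having no variable of [W] in
    common, they would be satisfied together. *)
Lemma MU_connected W F G : MU W F -> G `<=` F -> G != fset0 ->
  (forall C C' x x', C \in G -> C' \in F `\` G -> x \in C -> x' \in C' ->
     tag x \in W -> tag x <> tag x') -> G = F.
Proof.
move=> muF GF /fset0Pn[C0 C0G] sep.
have /eqVfproper[//|GpF] := GF.
have [phi1 h1] := proj2 muF G GpF.
have [phi2 h2] : sat W (F `\` G).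
  apply: (proj2 muF); rewrite fproperE fsubsetDl; apply/fsubsetPn; exists C0.
    exact: fsubsetP C0G.
  by rewrite !inE C0G.
have [C CF /negP[]] := MU_unsat (mix (var G) phi1 phi2) muF.
have [CG|CG] := boolP (C \in G).
  by apply: satb_eq (h1 C CG) => x xC xW; rewrite /mix (mem_var CG xC).
have CFG : C \in F `\` G by rewrite inE CG.
apply: satb_eq (h2 C CFG) => x xC xW; split=> //; rewrite /mix.
case: ifPn => // /varP[C' [x' [C'G x'C' xx']]].
by case: (sep C' C x' x); rewrite ?xx'.
Qed.

Definition part F (r : V) (p : {fset literal D} -> D r) (d : D r) : pre_clause_set D :=
  [fset C in F | p C == d].

Lemma mem_part F (r : V) (p : {fset literal D} -> D r) (d : D r) C :
  (C \in part F p d) = (C \in F) && (p C == d).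
Proof. by rewrite !inE. Qed.

Lemma part_sub F (r : V) (p : {fset literal D} -> D r) (d : D r) : part F p d `<=` F.
Proof. by apply/fsubsetP => C; rewrite mem_part => /andP[]. Qed.

(** The parts are the sets of the split on [r]. By connectedness each [S e] lies in a single part,
    which is part [e] because of a clause with [lit e]. As the [S e] cover [F] and the parts are
    disjoint, equality follows. *)
Lemma tightMU_part W F (r : V) (p : {fset literal D} -> D r) (d : D r) :
  tightMU W F -> is_root W F p -> tightMU (W `\ r) (part F p d).
Proof.
move=> tF [rW rF p1 p2]; have [S [SF tS litS SU _]] := tightMU_split tF rW rF.
have SP C : C \in F -> exists e, C \in S e.
  by rewrite -SU => /bigfcupP[e _ CS]; exists e.
have sSP e : S e `<=` part F p e.
  have [C CF eC] := MU_occurs e (proj1 tF) rW rF.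
  have CS : C \in S e.
    by have [e' CS'] := SP C CF; rewrite (litS _ _ _ CS' eC).
  suff <- : S e `&` part F p e = S e by apply: fsubsetIr.
  apply: (MU_connected (proj1 (tS e)) (fsubsetIl _ _)).
    by apply/fset0Pn; exists C; rewrite inE CS mem_part CF (p1 _ _ CF eC) eqxx.
  move=> C1 C2 x x' /fsetIP[C1S]; rewrite mem_part => /andP[C1F /eqP pC1].
  rewrite !inE => /andP[+ C2S] xC xC'; have C2F := fsubsetP (SF e) _ C2S.
  rewrite C2S C2F /= => /eqP pC2 /andP[xr xW] xx'; apply: pC2.
  by rewrite -pC1; apply/esym/(p2 C1 C2 x x').
suff -> : part F p d = S d by [].
apply/eqP; rewrite eqEfsubset sSP andbT; apply/fsubsetP => C.
rewrite mem_part => /andP[CF /eqP <-]; have [e CS] := SP C CF.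
by have := fsubsetP (sSP e) C CS; rewrite mem_part => /andP[_ /eqP ->].
Qed.

Lemma tightMU_rank0 W F : tightMU W F -> var F `&` W = fset0 -> exists C, F = [fset C].
Proof.
by move=> [_ cF] F0; apply/cardfs1P; rewrite cF /rank F0 weight0.
Qed.

Lemma occ_gt0 F (v : V) (e : D v) :
  reflect (exists2 C, C \in F & lit e \in C) (0 < occ F e)%N.
Proof.
rewrite cardfs_gt0; apply: (iffP (fset0Pn _)) => [[C]|[C CF eC]].
  by rewrite !inE => /andP[CF eC]; exists C.
by exists C; rewrite !inE CF.
Qed.

(** Descent through the parts ends at a root all of whose parts have rank 0. Each of these is a
    single clause, so every value of that root occurs once. *)
Lemma tightMU_leaf_var W F : tightMU W F -> var F `&` W != fset0 ->
  exists v, [/\ v \in var F, v \in W & forall e : D v, occ F e = 1%N].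
Proof.
have [n] := ubnP #|` W|; elim: n W F => // n IH W F leWn tF F0.
have [r [p rootp]] := exists_root tF F0; have [rW rF p1 p2] := rootp.
have tP d := tightMU_part d tF rootp.
have [[d P0]|Pn] := classic (exists d, var (part F p d) `&` (W `\ r) != fset0).
  have [|v [vP vW occv]] := IH (W `\ r) _ _ (tP d) P0.
    by move: leWn; rewrite (cardfsD1 r) rW; lia.
  move: vW; rewrite !inE => /andP[vr vW].
  exists v; split => // [|e]; first by apply: fsubsetP vP; apply/varS/part_sub.
  (* Parts share no variable except the root, so every occurrence of [v] in [F] lies in this
     part. *)
  rewrite -(occv e); congr (#|` _|); apply/fsetP => C; rewrite !inE /=.
  have [eC|] := boolP (lit e \in C); rewrite ?andbF // !andbT.
  have [CF|] := boolP (C \in F); rewrite // andTb.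
  have /varP[C' [x [+ xC' xv]]] := vP; rewrite mem_part => /andP[C'F /eqP <-].
  by apply/esym/eqP; apply: (p2 C C' (lit e) x).
exists r; split => // e.
have [|C PC] := tightMU_rank0 (tP e).
  by apply/eqP/negPn/negP => P0; apply: Pn; exists e.
apply/eqP; rewrite eqn_leq; apply/andP; split; last first.
  by apply/occ_gt0; apply: MU_occurs (proj1 tF) rW rF.
rewrite -(cardfs1 C) -PC; apply/fsubset_leq_card/fsubsetP => C'.
by rewrite !inE /= => /andP[C'F eC']; rewrite C'F (p1 _ _ C'F eC') eqxx.
Qed.

Lemma lit_inj (v : V) : injective (@lit V D v).
Proof. by move=> a b /eqP; rewrite eq_Tagged => /eqP. Qed.

Lemma mem_tree_Node (v : V) (ch : D v -> tree D) (B : {fset literal D}) :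
  reflect (exists d (B' : {fset literal D}), B' \in tree_clause_set (ch d) /\ B = lit d |` B')
          (B \in tree_clause_set (Node ch)).
Proof.
apply: (iffP (imfsetP _ _ _ _)) => [[q /= /allpairsPdep[d [q' [_ q't ->]]] ->]|].
  exists d, [fset x in q']; split; first by apply/imfsetP; exists q'.
  by apply/fsetP => x; rewrite !inE.
move=> [d [_ [/imfsetP[q' /= q't ->] ->]]]; exists (lit d :: q') => /=.
  by apply/allpairsPdep; exists d, q'; rewrite mem_enum.
by apply/fsetP => x; rewrite !inE.
Qed.

Lemma tree_leaf_set : tree_clause_set (@Leaf V D) = [fset fset0].
Proof.
apply/fsetP => B; rewrite !inE; apply/imfsetP/eqP => [[q /= + ->]|->].
  by rewrite inE => /eqP ->; apply/fsetP => x; rewrite !inE.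
by exists [::]; rewrite ?inE //; apply/fsetP => x; rewrite !inE.
Qed.

Lemma mem_inner_Node (v : V) (ch : D v -> tree D) u :
  (u \in inner_vars (Node ch)) = (u == v) || [exists d, u \in inner_vars (ch d)].
Proof.
rewrite inE; congr (_ || _); apply/flatten_mapP/existsP => [[d _ ud]|[d ud]].
  by exists d.
by exists d; rewrite ?mem_enum.
Qed.

Lemma tree_clause_var t (B : {fset literal D}) (x : literal D) :
  B \in tree_clause_set t -> x \in B -> tag x \in inner_vars t.
Proof.
elim: t B => [|v ch IH] B; first by rewrite tree_leaf_set !inE => /eqP ->.
case/mem_tree_Node => d [B' [B't ->]]; rewrite !inE => /predU1P[-> //=|xB'].
  by rewrite eqxx.
by have := mem_inner_Node ch (tag x); rewrite inE => ->; apply/orP; right;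
  apply/existsP; exists d; apply: IH xB'.
Qed.

Lemma uniq_flatten_map (I T : eqType) (f : I -> seq T) (s : seq I) :
  uniq s -> (forall i, uniq (f i)) ->
  (forall i j x, x \in f i -> x \in f j -> i = j) ->
  uniq (flatten [seq f i | i <- s]).
Proof.
move=> + uf disj; elim: s => //= i s IH /andP[is_ us].
rewrite cat_uniq uf IH // andbT; apply/hasPn => x /flatten_mapP[j js xj].
by apply: contraNN is_ => xi; rewrite (disj i j x).
Qed.

(** [g] sends a clause to the leaf reached by following its branches. For [W] the set of all
    variables, clauses lie inside their images, so [F] is the tree clause-set with literals
    missing. *)
Lemma tightMU_tree W F : tightMU W F ->
  exists (t : tree D) (g : {fset literal D} -> {fset literal D}),
    [/\ uniq (inner_vars t), {subset inner_vars t <= var F `&` W},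
        {in F &, injective g}, g @` F = tree_clause_set t
      & forall C x, C \in F -> x \in C -> tag x \in W -> x \in g C].
Proof.
have [n] := ubnP #|` W|; elim: n W F => // n IH W F leWn tF.
have [F0|F0] := eqVneq (var F `&` W) fset0.
  have [C FC] := tightMU_rank0 tF F0; exists Leaf, (fun=> fset0); split => //.
  - by move=> C1 C2; rewrite FC !inE => /eqP -> /eqP ->.
  - by rewrite FC tree_leaf_set imfset_fset1.
  move=> C' x CF xC xW; have : tag x \in var F `&` W by rewrite inE xW (mem_var CF).
  by rewrite F0.
have [r [p rootp]] := exists_root tF F0; have [rW rF p1 p2] := rootp.
have /fin_all_exists[tg tgP] : forall d,
    exists tg : tree D * ({fset literal D} -> {fset literal D}),
    [/\ uniq (inner_vars tg.1), {subset inner_vars tg.1 <= var (part F p d) `&` (W `\ r)},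
        {in part F p d &, injective tg.2}, tg.2 @` part F p d = tree_clause_set tg.1
      & forall C x, C \in part F p d -> x \in C -> tag x \in W `\ r -> x \in tg.2 C].
  move=> d; have [|t [g h]] := IH (W `\ r) _ _ (tightMU_part d tF rootp).
    by move: leWn; rewrite (cardfsD1 r) rW; lia.
  by exists (t, g).
have inP C : C \in F -> C \in part F p (p C) by move=> CF; rewrite mem_part CF eqxx.
have gP C : C \in F -> (tg (p C)).2 C \in tree_clause_set (tg (p C)).1.
  by move=> CF; have [_ _ _ <- _] := tgP (p C); apply: in_imfset; apply: inP.
have rN d (B : {fset literal D}) (e : D r) :
    B \in tree_clause_set (tg d).1 -> lit e \notin B.
  move=> Bt; apply/negP => /(tree_clause_var Bt) /=.
  by have [_ sub _ _ _] := tgP d => /sub; rewrite !inE /= eqxx !andbF.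
exists (Node (fun d => (tg d).1)), (fun C => lit (p C) |` (tg (p C)).2 C); split.
- rewrite [inner_vars _]/= cons_uniq; apply/andP; split.
    apply/flatten_mapP => -[d _]; have [_ sub _ _ _] := tgP d.
    by move/sub; rewrite !inE eqxx andbF.
  apply: uniq_flatten_map => [|d|d d' u]; first exact: enum_uniq.
    by have [] := tgP d.
  (* A label common to two subtrees would be a variable shared by two parts. *)
  have [_ sub _ _ _] := tgP d; have [_ sub' _ _ _] := tgP d'.
  move=> /sub/fsetIP[/varP[C [x [CP xC <-]]] xW] /sub'/fsetIP[/varP[C' [x' [CP' xC' xx']]] _].
  move: CP CP' xW; rewrite !mem_part !inE => /andP[CF /eqP <-] /andP[CF' /eqP <-] /andP[xr xW].
  exact: (p2 C C' x x' CF CF' xC xC' (esym xx') xW xr).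
- move=> u; rewrite mem_inner_Node => /predU1P[->|/existsP[d]]; first by rewrite inE rF.
  have [_ sub _ _ _] := tgP d => /sub; rewrite !inE => /andP[uP /andP[_ ->]].
  by rewrite andbT; apply: fsubsetP uP; apply/varS/part_sub.
- move=> C C' CF C'F gCC'.
  have pCC' : p C = p C'.
    have : lit (p C) \in lit (p C') |` (tg (p C')).2 C' by rewrite -gCC' !inE eqxx.
    by rewrite in_fset1U (negPf (rN _ _ _ (gP _ C'F))) orbF => /eqP/lit_inj.
  have [_ _ inj _ _] := tgP (p C); apply: inj; first exact: inP.
    by rewrite pCC'; apply: inP.
  have e1 := fsetU1K (rN _ _ (p C) (gP _ CF)).
  have e2 := fsetU1K (rN _ _ (p C') (gP _ C'F)).
  by rewrite -[LHS]e1 gCC' pCC' e2.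
- apply/fsetP => B; apply/imfsetP/mem_tree_Node => [[C /= CF ->]|[d [B' [+ ->]]]].
    by exists (p C), ((tg (p C)).2 C); split => //; apply: gP.
  have [_ _ _ <- _] := tgP d => /imfsetP[C /= CP ->].
  by move: CP; rewrite mem_part => /andP[CF /eqP <-]; exists C.
move=> C x CF xC xW; have [_ _ _ _ sub] := tgP (p C).
have [xr|xr] := eqVneq (tag x) r; last first.
  by rewrite in_fset1U (sub C x) ?orbT ?inP // !inE xr.
case: x xr xC {xW} => u e /= ur; move: e; rewrite ur => e eC.
by rewrite (p1 _ _ CF eC) !inE eqxx.
Qed.

(** * Literal elimination *)

Lemma satisfies_satb W F phi C : C \in F -> var F `<=` W ->
  satisfies phi C <-> satb W phi C.
Proof.
move=> CF /fsubsetP FW; split=> [[x xC xn]|/satbP[x [xC _ xn]]]; last by exists x.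
by apply/satbP; exists x; split => //; apply/FW/(mem_var CF).
Qed.

Lemma satisfiable_sat W F G : G `<=` F -> var F `<=` W -> satisfiable G <-> sat W G.
Proof.
move=> /fsubsetP GF FW.
by split=> -[phi h]; exists phi => C CG; apply/(satisfies_satb phi (GF C CG) FW)/h.
Qed.

Lemma MU1_tight F : MU1 F <-> tightMU (var F) F.
Proof.
have muE : minimally_unsatisfiable F <-> MU (var F) F.
  have eqsat G : G `<=` F -> satisfiable G <-> sat (var F) G.
    by move=> GF; apply: satisfiable_sat GF (fsubset_refl _).
  split=> -[nsF minF]; split=> [sF|G GF].
  - by apply: nsF; apply/(eqsat F).
  - by apply/eqsat; [apply: fproper_sub | apply: minF].
  - by apply: nsF; apply/(eqsat F).
  - by apply/eqsat; [apply: fproper_sub | apply: minF].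
rewrite /MU1 /tightMU /deficiency /rd /rank fsetIid -/(weight (var F)).
split=> -[/muE muF eF]; split => //; first by move: eF; set c := size _; lia.
by move: eF; set c := size _; lia.
Qed.

(** The leaf is reached by following at each inner node the edge labelled with the value under
    [phi]. *)
Lemma tree_falsified t phi :
  exists2 B : {fset literal D}, B \in tree_clause_set t &
    forall x : literal D, x \in B -> phi (tag x) = tagged x.
Proof.
elim: t => [|v ch IH].
  by exists fset0 => //; rewrite tree_leaf_set !inE.
have [B Bt h] := IH (phi v); exists (lit (phi v) |` B).
  by apply/mem_tree_Node; exists (phi v), B.
by move=> x; rewrite !inE => /predU1P[->|/h].
Qed.

(** The clash is at the node where the two root paths separate. *)
Lemma tree_clash t (B B' : {fset literal D}) :
  B \in tree_clause_set t -> B' \in tree_clause_set t -> B != B' ->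
  exists v (e e' : D v), [/\ lit e \in B, lit e' \in B' & e != e'].
Proof.
elim: t B B' => [|v ch IH] B B'.
  by rewrite tree_leaf_set !inE => /eqP -> /eqP ->; rewrite eqxx.
case/mem_tree_Node => d [A [At ->]] /mem_tree_Node[d' [A' [At' ->]]].
have [dd' ne|dd' _] := eqVneq d d'; last by exists v, d, d'; rewrite !inE !eqxx.
move: d' dd' At' ne => _ <- At' ne.
have AA' : A != A' by apply: contraNneq ne => ->.
have [u [e [e' [eA eA' ee']]]] := IH d A A' At At' AA'.
by exists u, e, e'; rewrite !inE eA eA' !orbT.
Qed.

Lemma uniq_inner_Node (v : V) (ch : D v -> tree D) : uniq (inner_vars (Node ch)) ->
  forall d, v \notin inner_vars (ch d) /\ uniq (inner_vars (ch d)).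
Proof.
rewrite [inner_vars _]/= cons_uniq => /andP[vN u] d; split.
  by apply: contraNN vN => vd; apply/flatten_mapP; exists d; rewrite ?mem_enum.
have : d \in enum (D v) by rewrite mem_enum.
elim: (enum _) u {vN} => //= a l IH; rewrite cat_uniq inE => /and3P[ua _ ul].
by case/predU1P => [->|/(IH ul)].
Qed.

Lemma tree_clause_set_clause t : tree_representation t -> @clause_set V D (tree_clause_set t).
Proof.
rewrite /tree_representation; elim: t => [|v ch IH] ut B.
  by rewrite tree_leaf_set !inE => /eqP -> x y.
case/mem_tree_Node => d [A [At ->]] x y; have [vN ud] := uniq_inner_Node ut d.
rewrite !inE => /predU1P[->|xA] /predU1P[->|yA] // xy.
- by case/negP: vN; rewrite (_ : v = tag y) //; apply: tree_clause_var At yA.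
- by case/negP: vN; rewrite (_ : v = tag x) //; apply: tree_clause_var At xA.
exact: (IH d ud A At).
Qed.

Lemma var_tree t : var (tree_clause_set t) =i inner_vars t.
Proof.
move=> u; apply/varP/idP => [[B [x [Bt xB <-]]]|]; first exact: tree_clause_var Bt xB.
elim: t => // v ch IH; rewrite mem_inner_Node => /predU1P[->|/existsP[d /IH]].
  have [B Bt _] := tree_falsified (ch (value0 v)) value0.
  exists (lit (value0 v) |` B), (lit (value0 v)).
  by split; rewrite ?inE ?eqxx //; apply/mem_tree_Node; exists (value0 v), B.
move=> [B [x [Bt xB xu]]]; exists (lit d |` B), x.
by split; rewrite ?inE ?xB ?orbT //; apply/mem_tree_Node; exists d, B.
Qed.

Lemma size_leaf_paths t :
  size (leaf_paths t) = (\sum_(v <- inner_vars t) (#|D v| - 1) + 1)%N.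
Proof.
elim: t => [|v ch IH] /=; first by rewrite big_nil.
rewrite size_allpairs_dep sumnE big_map big_cons big_flatten /= big_map.
rewrite (eq_bigr (fun e => \sum_(u <- inner_vars (ch e)) (#|D u| - 1) + 1)%N) //.
rewrite big_split /= sum1_size -cardE.
by move: (hD v) (\sum_(_ <- _) _)%N; set d := #|_|; lia.
Qed.

(** An assignment falsifying one leaf clause [B] satisfies every other one, since it clashes with
    [B]. The count of leaves bounds the deficiency above by 1, and [MU_rank] bounds it below. *)
Lemma tree_tightMU t : tree_representation t ->
  tightMU (var (tree_clause_set t)) (tree_clause_set t).
Proof.
move=> ut; set T := tree_clause_set t.
suff muT : MU (var T) T.
  split=> //; apply/eqP; rewrite eqn_leq MU_rank // andbT.
  rewrite /rank fsetIid /weight (perm_big (inner_vars t)); last first.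
    by apply: uniq_perm ut _ => //; apply: var_tree.
  rewrite -size_leaf_paths; apply: leq_trans (leq_imfset_card _ _ _) _ => /=.
  exact: size_undup.
split=> [[phi h]|G GT].
  have [B BT e] := tree_falsified t phi.
  by have /satbP[x [xB _]] := h B BT; rewrite e ?eqxx.
have /fsubsetPn[B BT BG] : ~~ (T `<=` G) by move: GT; rewrite fproperE => /andP[].
exists (fun v => if [pick e : D v | lit e \in B] is Some e then e else value0 v).
move=> C CG; have CT := fsubsetP (fproper_sub GT) C CG.
have BC : B != C by apply: contraNneq BG => ->.
have [v [e [e' [eB e'C ee']]]] := tree_clash BT CT BC.
apply/satbP; exists (lit e'); split; rewrite ?(mem_var CT e'C) //=.
case: pickP => [a aB|/(_ e)]; last by rewrite eB.
by rewrite (lit_inj (tree_clause_set_clause ut BT aB eB erefl)).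
Qed.

(** Size and variables are unchanged, so minimality is the point. Suppose [G'] is a proper minimally
    unsatisfiable subset of [G], and let [H] be [G'] with [x] put back into [C]. Counting shows that
    [v] is absent from [G']; then [H] can serve as the branch of [F] at [e], and this branch misses
    a second clause with the literal [x]. *)
Lemma tightMU_eliminate F G (C : {fset literal D}) (x : literal D) :
  tightMU (var F) F -> C \in F -> x \in C -> G = (C `\ x) |` (F `\ C) ->
  (forall v, ~ pure F v -> ~ pure G v) -> tightMU (var G) G.
Proof.
case: x => v e [muF cF] CF; rewrite -/(lit e) => eC defG np; set x := lit e in eC defG.
set W := var F in muF cF *.
have vW : v \in W by apply: mem_var CF eC.
(* All values of [v] occur in [F], so [v] must not become pure; hence [x] occurs in a clause other
   than [C]. *)
have [C1 C1F eC1] : exists2 C1, C1 \in F `\ C & lit e \in C1.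
  have /occ_gt0[C1] : (0 < occ G e)%N.
    rewrite lt0n; apply/eqP => G0; apply: (np v); last by exists e.
    case=> d F0; have := MU_occurs d muF vW vW.
    by move/occ_gt0; rewrite F0.
  by rewrite defG in_fset1U => /predU1P[->|C1F eC1]; [rewrite !inE eqxx | exists C1].
have satD phi : satb W phi (C `\ x) -> satb W phi C.
  by case/satbP => y [+ yW yn]; rewrite !inE => /andP[_ yC]; apply/satbP; exists y.
have FG (phi : forall v, D v) :
    (forall C, C \in G -> satb W phi C) -> forall C, C \in F -> satb W phi C.
  move=> h B BF; have [->|BC] := eqVneq B C.
    by apply/satD/h; rewrite defG !inE eqxx.
  by apply: h; rewrite defG !inE BC BF orbT.
(* If the shortened clause were already present, [G] would be [F] without [C], which is satisfiable,
   and with it [F]. *)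
have DF : C `\ x \notin F `\ C.
  apply/negP => DF; have [phi h] := proj2 muF _ (fproperD1 CF).
  apply: (proj1 muF); exists phi; apply: FG => B.
  by rewrite defG in_fset1U => /predU1P[->|]; apply: h.
have cG : #|` G| = #|` F|.
  by rewrite defG cardfsU1 DF (cardfsD1 C F) CF.
have GW : var G = W.
  apply/eqP; rewrite eqEfsubset; apply/andP; split; apply/fsubsetP => u.
    rewrite defG varU inE => /orP[]/varP[B [y []]].
      rewrite !inE => /eqP-> /[!inE] /andP[_ yC] <-; exact: mem_var CF yC.
    by rewrite !inE => /andP[_ BF] yB <-; apply: mem_var BF yB.
  case/varP => B [y [BF yB <-]].
  have [BC|BC] := eqVneq B C; last by apply: mem_var yB; rewrite defG !inE BC BF orbT.
  have [->|yx] := eqVneq y x; first by apply: mem_var eC1; rewrite defG in_fsetU C1F orbT.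
  by apply: (@mem_var _ (C `\ x)); rewrite ?defG !inE ?eqxx ?yx -?BC.
rewrite GW; split; last by rewrite cG cF /rank GW.
have nsG : ~ sat W G by move=> [phi /FG h]; apply: (proj1 muF); exists phi.
have [G' G'G muG'] := exists_MU nsG.
have [<-//|G'pG] := eqVfproper G'G; exfalso.
have CG : C \notin G.
  rewrite defG !inE eqxx orbF; apply/eqP => CD.
  by have := eC; rewrite CD !inE eqxx.
have DG' : C `\ x \in G'.
  apply/negPn/negP => DG'; apply: (proj1 muG').
  apply: sat_sub (proj2 muF _ (fproperD1 CF)); apply/fsubsetP => B BG'.
  have := fsubsetP G'G B BG'; rewrite defG in_fset1U => /predU1P[BD|//].
  by rewrite BD (negPf DG') in BG'.
set H := C |` (G' `\ (C `\ x)).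
have HP (B : {fset literal D}) : B \in H -> B = C \/ B \in G'.
  by rewrite !inE => /predU1P[->|/andP[_]]; [left | right].
have HsF : H `<=` F.
  apply/fsubsetP => B; rewrite in_fset1U => /predU1P[->//|].
  rewrite in_fsetD1 => /andP[BD /(fsubsetP G'G)].
  by rewrite defG in_fset1U (negPf BD) /= => /fsetD1P[].
have HF : H `<` F.
  rewrite fproperE HsF; move: G'pG; rewrite fproperE => /andP[_ /fsubsetPn[B BG BG']].
  move: BG; rewrite defG in_fset1U => /predU1P[BD|/fsetD1P[BC BF]].
    by rewrite BD DG' in BG'.
  by apply/fsubsetPn; exists B => //; apply/negP => /HP[/eqP|]; apply/negP.
have cH : #|` H| = #|` G'|.
  rewrite cardfsU1 (cardfsD1 (C `\ x) G') DG' in_fsetD1 negb_and.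
  by rewrite (contraNN (fsubsetP G'G C) CG) orbT.
have HE (B : {fset literal D}) : (B \in H) = (B == C) || (B != C `\ x) && (B \in G').
  by rewrite !inE.
(* If [v] occurred in [G'], restoring [x] would add no variable, and [H] would be a proper subset of
   [F] of deficiency at least 1. *)
clearbody H; have vG' : v \notin var G'.
  apply/negP => vG'.
  have : (rank W H <= rank W G')%N.
    apply/weight_le/fsetSI/fsubsetP => u /varP[B [y [/HP[->|BG'] yB <-]]].
      have [->//|yx] := eqVneq y x.
      by apply: mem_var DG' _; rewrite !inE yx.
    exact: mem_var BG' yB.
  move=> leHG'; have := MU_surplus muF HF.
  rewrite cH cF -addnA [X in (_ <= X)%N]addnC leq_add2r.
  by move/(leq_trans (MU_rank muG')); rewrite addn1 ltnNge leHG'.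
have [S [SF muS litS _ _]] := MU_split muF vW vW.
pose S' d := if d == e then H else S d.
have litS' d (B : {fset literal D}) d' : B \in S' d -> lit d' \in B -> d' = d.
  rewrite /S'; case: eqP => [-> /HP[->|BG']|_]; last exact: litS.
    move=> dC; apply/eqP/negPn/negP => d'e; case/negP: vG'.
    apply: (mem_var (x := lit d') DG'); rewrite !inE dC andbT.
    by apply: contraNN d'e => /eqP/lit_inj ->.
  by move=> dB; case/negP: vG'; apply: (mem_var (x := lit d') BG').
have SU' : \bigcup_(d <- enum (D v)) S' d = F.
  apply: split_cover muF _ _ litS' => d; rewrite /S'; case: eqP => // _.
    case=> phi h; apply: (proj1 muG'); exists phi => B BG'.
    have [->|BD] := eqVneq B (C `\ x).
      have /satbP[y [yC /fsetD1P[yv yW] yn]] : satb (W `\ v) phi C.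
        by apply: h; rewrite HE eqxx.
      apply/satbP; exists y; split => //; rewrite !inE yC andbT.
      by apply: contraNneq yv => ->.
    have : satb (W `\ v) phi B by apply: h; rewrite HE BD BG' orbT.
    by apply: satb_eq => y _ /fsetD1P[].
  by case: (muS d).
have /fsetD1P[C1C C1F'] := C1F.
move: C1F'; rewrite -SU' => /bigfcupP[d _ C1S].
have ed := litS' _ _ _ C1S eC1; move: C1S; rewrite -ed /S' eqxx => /HP[/eqP|C1G'].
  by rewrite (negPf C1C).
by case/negP: vG'; apply: (mem_var (x := lit e) C1G').
Qed.

Lemma MU1_eliminate F G : clause_set F /\ MU1 F -> elimination_step F G ->
  clause_set G /\ MU1 G.
Proof.
move=> [clF /MU1_tight tF] [C [x [CF xC defG np]]]; split.
  move=> B; rewrite defG in_fset1U => /predU1P[->|/fsetD1P[_ /clF //]].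
  by move=> y z; rewrite !inE => /andP[_ yC] /andP[_ zC]; apply: (clF C CF).
by apply/MU1_tight; apply: tightMU_eliminate tF CF xC defG np.
Qed.

Lemma MU1_literal_elimination F G : clause_set F /\ MU1 F -> literal_elimination F G ->
  clause_set G /\ MU1 G.
Proof.
move=> + FG; elim: FG => [F1 F2 /[swap]|F1 F2 F3 _ IH1 _ IH2 /IH1/IH2 //].
exact: MU1_eliminate.
Qed.

(** Induction on the number of missing literals: one is put back into a clause of [F], and its
    removal is the last elimination step. [critF] and [unT] keep the enlarged clause distinct from
    the others; [occF] prevents pure variables. *)
Lemma literal_elimination_map W F T (g : {fset literal D} -> {fset literal D}) :
  {in F &, injective g} -> g @` F = T -> (forall C, C \in F -> C `<=` g C) ->
  (forall C, C \in F -> sat W (F `\ C)) ->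
  (forall phi, exists2 B : {fset literal D}, B \in T &
     forall x : literal D, x \in B -> phi (tag x) = tagged x) ->
  (forall (u : V) (e : D u), u \in var T -> (0 < occ F e)%N) ->
  F = T \/ literal_elimination T F.
Proof.
have [n] := ubnP (\sum_(C <- F) #|` g C `\` C|).
elim: n F g => // n IH F g len ginj gF subg critF unT occF.
have [gid|] := classic (forall C, C \in F -> g C = C).
  left; rewrite -gF; apply/fsetP => B; apply/idP/imfsetP => [BF|[C /= CF ->]].
    by exists B; rewrite ?gid.
  by rewrite gid.
move=> /not_all_ex_not[C nC]; have [CF gC] := imply_to_and _ _ nC.
have [x xg xC] : exists2 x, x \in g C & x \notin C.
  by apply/fsubsetPn; apply/negP => gCC; apply: gC; apply/eqP; rewrite eqEfsubset gCC subg.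
set C' := x |` C.
have C'g : C' `<=` g C by rewrite fsubUset fsub1set xg subg.
have satC phi : satb W phi C -> satb W phi C'.
  by case/satbP => y [yC yW yn]; apply/satbP; exists y; rewrite !inE yC orbT.
(* If [C'] were another clause of [F], satisfying [F] without [C'] would satisfy [C], hence [C'],
   hence all of [F] and all the larger clauses in [T]. *)
have nC' : C' \notin F `\ C.
  apply/negP => /fsetD1P[C'C C'F]; have [phi h] := critF C' C'F.
  have hC : satb W phi C by apply: h; rewrite !inE eq_sym C'C.
  have [B] := unT phi; rewrite -gF => /imfsetP[A /= AF ->] fA.
  have /satbP[y [yA _]] : satb W phi A.
    by have [->|AC'] := eqVneq A C'; [apply: satC | apply: h; rewrite !inE AC'].
  by rewrite fA ?eqxx //; apply: fsubsetP yA; apply: subg.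
set F' := C' |` (F `\ C); pose g' (B : {fset literal D}) := if B == C' then g C else g B.
have g'E (B : {fset literal D}) : B \in F `\ C -> g' B = g B.
  by move=> BF; rewrite /g'; case: eqP => // BC; rewrite -BC BF in nC'.
have g'C' : g' C' = g C by rewrite /g' eqxx.
have F'P (B : {fset literal D}) : B \in F' -> B = C' \/ [/\ B \in F `\ C, B \in F & B != C].
  rewrite in_fset1U => /predU1P[->|BF]; [by left | right].
  by split => //; have /fsetD1P[] := BF.
have stepF : elimination_step F' F.
  exists C', x; split; rewrite ?fset1U1 //.
    by rewrite fsetU1K // fsetU1K // fsetD1K.
  move=> u nu [e F0]; have u0 : (0 < occ F' e)%N.
    by rewrite lt0n; apply/eqP => F'0; apply: nu; exists e.
  suff uT : u \in var T by have := occF u e uT; rewrite F0.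
  have [B BF' eB] := occ_gt0 _ _ u0; rewrite -gF.
  have [BC'|[_ BF _]] := F'P B BF'.
    apply: (@mem_var _ (g C) (lit e)); first exact: in_imfset.
    by apply: (fsubsetP C'g); rewrite -BC'.
  apply: (@mem_var _ (g B) (lit e)); first exact: in_imfset.
  by apply: (fsubsetP (subg B BF)).
suff [<-|TF'] : F' = T \/ literal_elimination T F'.
  by right; apply: Relation_Operators.t_step.
  by right; apply: Relation_Operators.t_trans TF' _; apply: Relation_Operators.t_step.
apply: (IH F' g') => //.
- move: len; rewrite (big_fsetD1 C) //= big_fsetU1 //= g'C'.
  have -> : \sum_(B <- F `\ C) #|` g' B `\` B| = \sum_(B <- F `\ C) #|` g B `\` B|.
    by apply: eq_big_seq => B BF; rewrite g'E.
  set s := (\sum_(i <- _) _)%N; suff : (#|` g C `\` C'| < #|` g C `\` C|)%N by fset_lia.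
  apply: fproper_ltn_card; rewrite fproperE; apply/andP; split.
    by apply: fsetDS; apply: fsubsetU1.
  by apply/fsubsetPn; exists x; rewrite !inE ?eqxx ?xg ?xC.
- move=> B1 B2 /F'P[->|[B1C B1F n1]] /F'P[->|[B2C B2F n2]] //; rewrite ?g'C' ?g'E //.
  + by move/(ginj _ _ CF B2F) => e2; rewrite e2 eqxx in n2.
  + by move/(ginj _ _ B1F CF) => e1; rewrite e1 eqxx in n1.
  exact: ginj.
- rewrite -gF; apply/fsetP => B; apply/imfsetP/imfsetP => -[A /= AF ->].
    have [->|[AC AF' _]] := F'P A AF; first by rewrite g'C'; exists C.
    by rewrite g'E //; exists A.
  have [->|AC] := eqVneq A C; first by exists C'; rewrite ?fset1U1.
  have AFC : A \in F `\ C by rewrite in_fsetD1 AC.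
  by exists A; rewrite ?g'E // in_fsetU AFC orbT.
- by move=> B /F'P[->|[BC BF _]]; rewrite ?g'C' ?g'E //; apply: subg.
- move=> B /F'P[->|[BC BF nBC]]; first by rewrite fsetU1K //; apply: critF.
  have [phi h] := critF B BF; exists phi => A /fsetD1P[AB /F'P[->|[_ AF _]]].
    by apply/satC/h; rewrite !inE eq_sym nBC.
  by apply: h; rewrite in_fsetD1 AB.
move=> u e uT; have [B BF eB] := occ_gt0 _ _ (occF u e uT); apply/occ_gt0.
have [BC|BC] := eqVneq B C.
  by exists C'; rewrite ?fset1U1 // in_fsetU -BC eB orbT.
by exists B => //; rewrite in_fsetU in_fsetD1 BC BF orbT.
Qed.

Theorem MU1_tree_iff F : clause_set F /\ MU1 F <->
  exists t : tree D, tree_representation t /\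
    (F = tree_clause_set t \/ literal_elimination (tree_clause_set t) F).
Proof.
have treeP t : tree_representation t ->
    @clause_set V D (tree_clause_set t) /\ @MU1 V D (tree_clause_set t).
  by move=> rt; split; [apply: tree_clause_set_clause | apply/MU1_tight/tree_tightMU].
split=> [[clF /MU1_tight tF]|[t [/treeP tT [->//|]]]]; last exact: MU1_literal_elimination.
have [t [g [ut sub ginj gF subg]]] := tightMU_tree tF.
exists t; split => //; apply: (@literal_elimination_map (var F) _ _ g) => //.
- by move=> C CF; apply/fsubsetP => x xC; apply: subg => //; apply: mem_var CF xC.
- by move=> C CF; apply: (proj2 (proj1 tF)); apply: fproperD1.
- exact: tree_falsified.
move=> u e; rewrite var_tree => /sub; rewrite fsetIid => uF.
by apply/occ_gt0; apply: (MU_occurs e (proj1 tF) uF uF).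
Qed.

(** * Singular DP-reduction *)

(** A plain function with membership on the side, unlike in [resolvents], so that one parent can be
    exchanged and the same parents used for a subset of [F]. *)
Definition parents F (v : V) (P : D v -> {fset literal D}) : Prop :=
  forall e, P e \in F /\ lit e \in P e.

Definition resolve (v : V) (P : D v -> {fset literal D}) : {fset literal D} :=
  \bigcup_(e <- enum (D v)) [fset x in P e | tag x != v].

Lemma mem_resolve (v : V) (P : D v -> {fset literal D}) (x : literal D) :
  reflect (tag x != v /\ exists e, x \in P e) (x \in resolve P).
Proof.
apply: (iffP (bigfcupP _ _ _ _)) => [[e _]|[xv [e xP]]].
  by rewrite !inE => /andP[xP xv]; split => //; exists e.
by exists e; rewrite ?mem_enum // !inE xP.
Qed.

Lemma eq_resolve (v : V) (P Q : D v -> {fset literal D}) : P =1 Q -> resolve P = resolve Q.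
Proof. by move=> PQ; apply: eq_bigr => e _; rewrite PQ. Qed.

Lemma in_resolvents F (v : V) C :
  C \in resolvents F v <->
  exists P : D v -> {fset literal D}, [/\ parents F P, is_clause (resolve P) & C = resolve P].
Proof.
split=> [/imfsetP[P /=]|[P [FP clP ->]]].
  rewrite inE => /andP[/forallP litP /is_clauseP clP] ->.
  by exists (fun e => val (P e)); split => // e; split; [apply: valP | apply: litP].
apply/imfsetP; exists [ffun e => [` (FP e).1]] => /=.
  rewrite inE; apply/andP; split; first by apply/forallP => e; rewrite ffunE; apply: (FP e).2.
  apply/is_clauseP; suff -> : resolvent [ffun e => [` (FP e).1]] = resolve P by [].
  by apply: eq_bigr => e _; rewrite ffunE.
by apply: eq_bigr => e _; rewrite ffunE.
Qed.

Definition free F (v : V) : pre_clause_set D := [fset C in F | v \notin clause_var C].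

Lemma clause_varP C (v : V) : reflect (exists e : D v, lit e \in C) (v \in clause_var C).
Proof.
apply: (iffP (imfsetP _ _ _ _)) => [[[u e] /= uC ->]|[e eC]]; first by exists e.
by exists (lit e).
Qed.

Lemma in_free F (v : V) C : (C \in free F v) = (C \in F) && (v \notin clause_var C).
Proof. by rewrite !inE. Qed.

Lemma mem_DP F (v : V) C : C \in DP v F <->
  C \in free F v \/
  exists P : D v -> {fset literal D}, [/\ parents F P, is_clause (resolve P) & C = resolve P].
Proof.
rewrite inE; split=> [/orP[|/in_resolvents]|[->|/in_resolvents ->]]; rewrite ?orbT //; auto.
Qed.

Lemma DP_clause_set F (v : V) : clause_set F -> clause_set (DP v F).
Proof.
by move=> clF C /mem_DP[|[P [_ clP ->]] //]; rewrite in_free => /andP[/clF].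
Qed.

Lemma lit_uniq F C (v : V) (e e' : D v) :
  clause_set F -> C \in F -> lit e \in C -> lit e' \in C -> e = e'.
Proof. by move=> clF CF eC eC'; apply: lit_inj (clF C CF _ _ eC eC' erefl). Qed.

Lemma literal_of (x : literal D) (v : V) : tag x = v -> exists e : D v, x = lit e.
Proof. by case: x => u e /= <-; exists e. Qed.

(* A parent [P (phi v)] of a resolvent is falsified at [v] by [phi]. *)
Lemma satisfies_resolve F (v : V) (P : D v -> {fset literal D}) phi :
  clause_set F -> parents F P -> (forall e, satisfies phi (P e)) ->
  satisfies phi (resolve P).
Proof.
move=> clF FP satP; have [x xP xn] := satP (phi v); exists x => //.
apply/mem_resolve; split; last by exists (phi v).
apply/eqP => /literal_of[e xe]; have [PF vP] := FP (phi v).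
by move: xn; rewrite xe (lit_uniq (e := e) clF PF _ vP) ?eqxx // -xe.
Qed.

Lemma satisfies_update F (v : V) (e : D v) phi C :
  (exists2 x, x \in C & tag x != v /\ phi (tag x) != tagged x) \/
  (exists2 e', lit e' \in C & e' != e) ->
  satisfies (dfwith phi e) C.
Proof.
case=> [[x xC [xv xn]]|[e' eC ee']]; first by exists x; rewrite // dfwith_out // eq_sym.
by exists (lit e'); rewrite //= dfwith_in eq_sym.
Qed.

(* If, for every value of [v], [phi] falsifies some parent outside [v], then it
   falsifies every literal of their resolvent, which hence has no clash. *)
Lemma DP_satisfiable H (v : V) phi :
  (forall C, C \in free H v -> satisfies phi C) ->
  (forall P : D v -> {fset literal D}, parents H P -> is_clause (resolve P) ->
     satisfies phi (resolve P)) ->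
  satisfiable H.
Proof.
move=> satN satR.
pose out C := has (fun x : literal D => (tag x != v) && (phi (tag x) != tagged x)) C.
have outP C : reflect (exists2 x, x \in C & tag x != v /\ phi (tag x) != tagged x) (out C).
  by apply: (iffP hasP) => -[x xC xh]; exists x => //; apply/andP.
have [/existsP[e /allP he]|/existsPn nh] :=
  boolP [exists e : D v, all (fun C => (lit e \in C) ==> out C) H].
  exists (dfwith phi e) => C CH; apply: (@satisfies_update H).
  have [eC|eC] := boolP (lit e \in C); first by left; apply/outP/(implyP (he C CH)).
  have [/clause_varP[e' e'C]|vC] := boolP (v \in clause_var C).
    by right; exists e' => //; apply: contraNneq eC => <-.
  have [|x xC xn] := satN C; first by rewrite in_free CH.
  left; exists x => //; split => //; apply: contraNneq vC => xv.
  by apply/imfsetP; exists x.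
have /fin_all_exists[P PH] : forall e : D v, exists C, [/\ C \in H, lit e \in C & ~~ out C].
  by move=> e; have /allPn[C CH] := nh e; rewrite negb_imply => /andP[eC oC]; exists C.
have falseR x : x \in resolve P -> phi (tag x) = tagged x.
  case/mem_resolve => xv [e xP]; have [_ _ /outP nout] := PH e.
  by apply/eqP/negPn/negP => xn; apply: nout; exists x.
have [|x y xR yR xy|x xR] := satR P; first by move=> e; have [] := PH e.
  have := falseR x xR; have := falseR y yR; case: x xy {xR} => u d /= xy.
  by have [d' ->] := literal_of (esym xy) => /= -> ->.
by rewrite falseR ?eqxx.
Qed.

Lemma satisfiable_DP F (v : V) : clause_set F -> satisfiable F <-> satisfiable (DP v F).
Proof.
move=> clF; split=> -[phi h].
  exists phi => C /mem_DP[|[P [FP _ ->]]]; first by rewrite in_free => /andP[/h].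
  by apply: (satisfies_resolve clF FP) => e; apply/h; have [] := FP e.
apply: (DP_satisfiable (v := v) (phi := phi)) => [C CN|P FP clP].
  by apply/h/mem_DP; left.
by apply/h/mem_DP; right; exists P.
Qed.

(** * Counting resolvents *)

Lemma occ_sum F (v : V) (e : D v) : occ F e = (\sum_(C <- F) (lit e \in C))%N.
Proof. by rewrite /occ card_fset_sum1 -big_fset_condE big_mkcond. Qed.

(** A clause containing [v] does so with exactly one value and is counted once in the sum. *)
Lemma card_free F (v : V) : clause_set F ->
  (#|` free F v| + \sum_(e : D v) occ F e = #|` F|)%N.
Proof.
move=> clF; rewrite (eq_bigr _ (fun e _ => occ_sum F e)) exchange_big /=.
rewrite card_fset_sum1 -big_fset_condE big_mkcond -big_split card_fset_sum1 /=.
apply: eq_big_seq => C CF; have [/clause_varP[e eC]|/clause_varP nC] /= := boolP (v \in _).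
  rewrite (bigD1 e) //= eC big1 // => e' ee'.
  by apply/eqP; rewrite eqb0; apply: contraNN ee' => /(lit_uniq clF CF eC) ->.
by rewrite big1 // => e _; apply/eqP; rewrite eqb0; apply/negP => eC; apply: nC; exists e.
Qed.

Definition choices F (v : V) : {fset {ffun D v -> F}} :=
  [fset P in [pred P : {ffun D v -> F} | [forall e, lit e \in val (P e)]]].

Lemma card_choices F (v : V) : #|` choices F v| = (\prod_(e : D v) occ F e)%N.
Proof.
rewrite card_imfset //= -cardE.
transitivity #|(family (fun e : D v => [pred c : F | lit e \in val c]))|.
  by apply: eq_card => P; rewrite !inE; apply/forallP/familyP => h e; have := h e; rewrite inE.
rewrite card_family foldrE big_map -/(index_enum _) big_enum; apply: eq_bigr => e _.
by rewrite occ_sum big_seq_fsetE -sum1_card big_mkcond.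
Qed.

(** The cardinality in the definition is the largest possible. Attaining it rules out each of the
    three losses: a clash, two choices with the same resolvent, and a resolvent already present
    without [v]. *)
Lemma nondegenerate_resolvents F (v : V) : clause_set F -> nondegenerated F v ->
  [/\ forall P : D v -> _, parents F P -> is_clause (resolve P),
      forall P Q : D v -> _, parents F P -> parents F Q -> resolve P = resolve Q -> P =1 Q
    & forall P : D v -> _, parents F P -> resolve P \notin free F v].
Proof.
move=> clF [_ cDP]; have cF := card_free v clF; have cA := card_choices F v.
set A := choices F v in cA.
pose A' := [fset P in A | is_clauseb (resolvent P)].
have RA : resolvents F v = @resolvent V D F v @` A'.
  apply/fsetP => C; apply/imfsetP/imfsetP => -[P /= PA ->]; exists P => //.
    by move: PA; rewrite !inE.
  by move: PA; rewrite !inE.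
have A'A : A' `<=` A by apply/fsubsetP => P; rewrite !inE => /andP[].
have cR : (#|` resolvents F v| <= #|` A'|)%N by rewrite RA leq_imfset_card.
have cI := cardfsUI (free F v) (resolvents F v); rewrite -[_ `|` _]/(DP v F) in cI.
have cA' := fsubset_leq_card A'A.
have [eI eR eA] : [/\ #|` free F v `&` resolvents F v| = 0%N,
    #|` resolvents F v| = #|` A'| & #|` A'| = #|` A|].
  move: cDP cF cA cR cI cA'.
  set n1 := #|`_|; set n2 := #|`_|; set n3 := (\sum_(_ : _) _)%N; set n4 := (\prod_(_ : _) _)%N.
  set n5 := #|`_|; set n6 := #|`_|; set n7 := #|`_|; set n8 := #|`_|; set n9 := #|`_|.
  by split; lia.
have A'eq : A' = A by apply/eqP; rewrite eqEfcard A'A eA leqnn.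
have injA : {in A &, injective (@resolvent V D F v)}.
  by apply/card_in_imfsetP; rewrite -A'eq -RA eR.
have ffunP (P : D v -> {fset literal D}) : parents F P ->
    exists Q : {ffun D v -> F}, [/\ Q \in A, resolvent Q = resolve P & forall e, val (Q e) = P e].
  move=> FP; exists [ffun e => [` (FP e).1]]; split=> [||e]; last by rewrite ffunE.
    by rewrite !inE; apply/forallP => e; rewrite ffunE; apply: (FP e).2.
  by apply: eq_bigr => e _; rewrite ffunE.
have clP (P : D v -> _) : parents F P -> is_clause (resolve P).
  case/ffunP => Q [QA <- _]; apply/is_clauseP.
  by move: QA; rewrite -A'eq !inE => /andP[].
split=> // [P Q /ffunP[P' [PA <- PE]] /ffunP[Q' [QA <- QE]]|P FP].
  by move/(injA _ _ PA QA) => PQ e; rewrite -PE -QE PQ.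
apply/negP => RN; have : resolve P \in free F v `&` resolvents F v.
  by rewrite inE RN; apply/in_resolvents; exists P; split => //; apply: clP.
by rewrite (cardfs0_eq eI).
Qed.

Lemma satisfiable_proper F G : (forall C, C \in F -> satisfiable (F `\ C)) ->
  G `<` F -> satisfiable G.
Proof.
move=> crit; rewrite fproperE => /andP[/fsubsetP GF /fsubsetPn[C CF CG]].
have [phi h] := crit C CF; exists phi => B BG; apply: h.
by rewrite in_fsetD1 GF // andbT; apply: contraNneq CG => <-.
Qed.

Lemma singular_occ F (v : V) (e : D v) : singular F v -> exists2 C, C \in F & lit e \in C.
Proof.
case=> d [h1 hd]; apply/occ_gt0.
by have [->//|/eqP ed] := eqVneq e d; rewrite h1.
Qed.

Lemma singular_parents F (v : V) : singular F v ->
  exists P : D v -> {fset literal D}, parents F P.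
Proof.
move=> sv; have /fin_all_exists[P FP] : forall e : D v, exists C, C \in F /\ lit e \in C.
  by move=> e; have [C CF eC] := singular_occ e sv; exists C.
by exists P.
Qed.

Lemma singular_var F (v : V) : singular F v -> v \in var F.
Proof. by case/(singular_occ (value0 v)) => C CF; apply: mem_var CF. Qed.

Lemma var_DP_sub F (v : V) : var (DP v F) `<=` var F `\ v.
Proof.
apply/fsubsetP => u /varP[C [x [/mem_DP CG xC <-]]]; case: CG xC => [|[P [FP _ ->]] xC].
  rewrite in_free in_fsetD1 => /andP[CF vC] xC; rewrite (mem_var CF xC) andbT.
  by apply: contraNneq vC => <-; apply/imfsetP; exists x.
have /mem_resolve[xv [e xP]] := xC.
by rewrite in_fsetD1 xv; apply: mem_var xP; have [] := FP e.
Qed.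

(** As no choice of parents clashes, every clause with [v] passes its other variables on to a
    resolvent. *)
Lemma var_DP F (v : V) : clause_set F -> singular F v -> nondegenerated F v ->
  var (DP v F) = var F `\ v.
Proof.
move=> clF sv nv; have [clP _ _] := nondegenerate_resolvents clF nv.
apply/eqP; rewrite eqEfsubset var_DP_sub; apply/fsubsetP => u.
rewrite in_fsetD1 => /andP[+ /varP[C [x [CF xC xu]]]]; rewrite -xu => xv.
have [/clause_varP[e eC]|vC] := boolP (v \in clause_var C); last first.
  by apply: (@mem_var _ C) => //; apply/mem_DP; left; rewrite in_free CF.
have [P FP] := singular_parents sv.
pose Q d := if d == e then C else P d.
have FQ : parents F Q by move=> d; rewrite /Q; case: eqP => [->|_ //].
apply: (@mem_var _ (resolve Q)); first by apply/mem_DP; right; exists Q; split => //; apply: clP.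
by apply/mem_resolve; split => //; exists e; rewrite /Q eqxx.
Qed.

(** For singular [v] the sum of the occurrences exceeds their product by [#|D v| - 1], exactly the
    contribution of [v] to [rd]. *)
Lemma deficiency_DP F (v : V) : clause_set F -> singular F v -> nondegenerated F v ->
  deficiency (DP v F) = deficiency F.
Proof.
move=> clF sv nv; have [e [occ1 _]] := sv.
have rdF : rd F = (rd (DP v F) + (#|D v| - 1))%N.
  by rewrite /rd var_DP // (big_fsetD1 v) ?singular_var //= addnC.
have sumE : (\sum_(d : D v) occ F d = occ F e + (#|D v| - 1))%N.
  rewrite (bigD1 e) //= (eq_bigr (fun=> 1%N)) => [|d /eqP/occ1 //].
  by rewrite sum1_card cardC1 subn1.
have prodE : (\prod_(d : D v) occ F d = occ F e)%N.
  by rewrite (bigD1 e) //= big1 ?muln1 // => d /eqP/occ1.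
have [_] := nv; rewrite sumE prodE /deficiency rdF.
by move: (hD v); set d := #|_|; set n1 := #|`_|; set n2 := #|`_|; lia.
Qed.

(** A resolvent is determined by its parent at the value that may occur repeatedly, the other
    parents being unique. Satisfying [F] without that parent thus satisfies every other clause of
    the reduced set. *)
Lemma MU1_DP F (v : V) : clause_set F -> singular F v -> nondegenerated F v ->
  MU1 F -> MU1 (DP v F).
Proof.
move=> clF sv nv [[nsF minF] dF]; split; last by rewrite deficiency_DP.
have occP (P Q : D v -> {fset literal D}) (e0 : D v) : parents F P -> parents F Q ->
    (forall e, e <> e0 -> occ F e = 1%N) -> Q e0 = P e0 -> P =1 Q.
  move=> FP FQ occ1 PQ e; have [->//|/eqP /occ1 o1] := eqVneq e e0.
  have [PF eP] := FP e; have [QF eQ] := FQ e.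
  move/eqP: o1 => /cardfs1P[C FC].
  have: P e \in [fset C in F | lit e \in C] by rewrite !inE PF.
  have: Q e \in [fset C in F | lit e \in C] by rewrite !inE QF.
  by rewrite FC !inE => /eqP -> /eqP ->.
split=> [/(satisfiable_DP v clF) //|G]; apply: satisfiable_proper => R.
case/mem_DP => [|[P [FP clP ->]]].
  rewrite in_free => /andP[RF vR]; have [phi h] := minF _ (fproperD1 RF).
  exists phi => C /fsetD1P[CR /mem_DP[|[P [FP clP ->]]]].
    by rewrite in_free => /andP[CF _]; apply: h; rewrite in_fsetD1 CR.
  apply: (satisfies_resolve clF FP) => e; apply: h; have [PF eP] := FP e.
  by rewrite in_fsetD1 PF andbT; apply: contraNneq vR => <-; apply/clause_varP; exists e.
have [e0 [occ1 _]] := sv; have [PF e0P] := FP e0.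
have [phi h] := minF _ (fproperD1 PF).
exists phi => C /fsetD1P[CR /mem_DP[|[Q [FQ clQ eC]]]].
  rewrite in_free => /andP[CF vC]; apply: h; rewrite in_fsetD1 CF andbT.
  by apply: contraNneq vC => ->; apply/clause_varP; exists e0.
rewrite eC; apply: (satisfies_resolve clF FQ) => e; apply: h; have [QF eQ] := FQ e.
rewrite in_fsetD1 QF andbT; apply/eqP => QP.
have ee0 : e = e0 by apply: lit_uniq clF PF _ e0P; rewrite -QP.
case/eqP: CR; rewrite eC; apply: eq_resolve => d.
by apply/esym; apply: (occP P Q e0) => //; rewrite -QP ee0.
Qed.

(** To drop a clause [C] with [v], one resolvent with parent [C] is dropped. By injectivity it
    differs from all resolvents of the remaining clauses, so these are satisfiable by
    [DP_satisfiable]. *)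
Lemma DP_MU1 F (v : V) : clause_set F -> singular F v -> nondegenerated F v ->
  MU1 (DP v F) -> MU1 F.
Proof.
move=> clF sv nv [[nsG minG] dG]; split; last by rewrite -(deficiency_DP clF sv nv).
have [clP injP disjP] := nondegenerate_resolvents clF nv.
split=> [/(satisfiable_DP v clF) //|G]; apply: satisfiable_proper => C CF.
have [/clause_varP[e eC]|vC] := boolP (v \in clause_var C); last first.
  have CN : C \in free F v by rewrite in_free CF.
  have CG : C \in DP v F by apply/mem_DP; left.
  have [phi h] := minG _ (fproperD1 CG).
  apply: (DP_satisfiable (v := v) (phi := phi)) => [B|P FP clR].
    rewrite in_free => /andP[/fsetD1P[BC BF] vB]; apply: h; rewrite in_fsetD1 BC.
    by apply/mem_DP; left; rewrite in_free BF.
  have FP' : parents F P by move=> d; have [/fsetD1P[]] := FP d.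
  apply: h; rewrite in_fsetD1; apply/andP; split.
    by apply: contraTneq CN => <-; apply: disjP.
  by apply/mem_DP; right; exists P.
have [P0 FP0] := singular_parents sv.
pose P d := if d == e then C else P0 d.
have FP : parents F P by move=> d; rewrite /P; case: eqP => [->|_ //].
have RG : resolve P \in DP v F by apply/mem_DP; right; exists P; split => //; apply: clP.
have [phi h] := minG _ (fproperD1 RG).
apply: (DP_satisfiable (v := v) (phi := phi)) => [B|Q FQ clR].
  rewrite in_free => /andP[/fsetD1P[BC BF] vB]; apply: h; rewrite in_fsetD1.
  have BN : B \in free F v by rewrite in_free BF.
  apply/andP; split; last by apply/mem_DP; left.
  by apply: contraTneq BN => ->; apply: disjP.
have FQ' : parents F Q by move=> d; have [/fsetD1P[]] := FQ d.
apply: h; rewrite in_fsetD1; apply/andP; split; last by apply/mem_DP; right; exists Q.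
apply/eqP => /(injP _ _ FQ' FP)/(_ e); rewrite /P eqxx => QC.
by have [/fsetD1P[]] := FQ e; rewrite QC eqxx.
Qed.

(** Let [phi] satisfy the clauses without [v]. Were it to satisfy a literal of the only candidate
    resolvent, from the parent at [e], setting [v] to [e] would satisfy [F]. So [phi] falsifies the
    whole candidate, which is therefore free of clashes and new. *)
Lemma all_singly_nondegenerated F (v : V) : clause_set F -> minimally_unsatisfiable F ->
  (forall e : D v, occ F e = 1%N) -> nondegenerated F v.
Proof.
move=> clF [nsF minF] occ1; split; first by case=> e; rewrite occ1.
have sv : singular F v by exists (value0 v); rewrite occ1.
have [P FP] := singular_parents sv.
have onlyP e C : C \in F -> lit e \in C -> C = P e.
  move=> CF eC; have [PF eP] := FP e; have /eqP/cardfs1P[B FB] := occ1 e.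
  have: C \in [fset C in F | lit e \in C] by rewrite !inE CF.
  have: P e \in [fset C in F | lit e \in C] by rewrite !inE PF.
  by rewrite FB !inE => /eqP -> /eqP ->.
have NF : free F v `<` F.
  have [PF eP] := FP (value0 v); rewrite fproperE; apply/andP; split.
    by apply/fsubsetP => C; rewrite in_free => /andP[].
  apply/fsubsetPn; exists (P (value0 v)) => //; rewrite in_free PF negbK.
  by apply/clause_varP; exists (value0 v).
have [phi h] := minF _ NF.
have falseR x : x \in resolve P -> phi (tag x) = tagged x.
  case/mem_resolve => xv [e xP]; apply/eqP/negPn/negP => xn.
  apply: nsF; exists (dfwith phi e) => C CF; apply: (@satisfies_update F).
  have [/clause_varP[e' e'C]|vC] := boolP (v \in clause_var C); last first.
    have [|y yC yn] := h C; first by rewrite in_free CF.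
    left; exists y => //; split => //; apply: contraNneq vC => yv.
    by apply/imfsetP; exists y.
  have [ee'|ee'] := eqVneq e' e; last by right; exists e'.
  by left; exists x; rewrite // (onlyP e' C CF e'C) ee'.
have clR : is_clause (resolve P).
  move=> x y /falseR + /falseR; case: x => u d; case: y => u' d' /= + + uu'.
  by move: d'; rewrite -uu' => d' -> ->.
have RN : resolve P \notin free F v.
  by apply/negP => /h[x /falseR ->]; rewrite eqxx.
have -> : DP v F = resolve P |` free F v.
  apply/fsetP => C; rewrite in_fset1U; apply/idP/predU1P => [/mem_DP[|[Q [FQ _ ->]]]|].
  - by right.
  - by left; apply: eq_resolve => e; have [QF eQ] := FQ e; apply: onlyP.
  by case=> [->|CN]; apply/mem_DP; [right; exists P | left].
have := card_free v clF; rewrite cardfsU1 RN.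
have -> : (\prod_(e : D v) occ F e = 1)%N by apply: big1 => e _; exact: occ1.
by set d := (\sum_(_ : _) _)%N; set n1 := #|`_|; set n2 := #|`_|; lia.
Qed.

(** * End results of the reduction *)

Lemma MU1_bot : MU1 (@bot_set V D).
Proof.
apply/MU1_tight; rewrite /bot_set -tree_leaf_set; exact: tree_tightMU.
Qed.

Lemma MU1_irreducible F : clause_set F -> MU1 F -> sDP_irreducible F -> F = bot_set.
Proof.
move=> clF mF irr; have /MU1_tight tF := mF.
have [F0|F0] := eqVneq (var F `&` var F) fset0; last first.
  have [v [vF _ occ1]] := tightMU_leaf_var tF F0.
  case: (irr (DP v F)); exists v; split=> //; last first.
    by apply: all_singly_nondegenerated => //; case: mF.
  by exists (value0 v); rewrite occ1.
have [C FC] := tightMU_rank0 tF F0; rewrite FC; congr [fset _].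
apply/fsetP => x; rewrite in_fset0; apply/negP => xC.
have: tag x \in var F by apply: (@mem_var _ C); rewrite ?FC ?inE.
by rewrite -[var F]fsetIid F0.
Qed.

Lemma sDP_reduces_MU1 F G : sDP_reduces F G -> clause_set F ->
  clause_set G /\ (MU1 F <-> MU1 G).
Proof.
elim=> [F1 F2 [v [sv nv ->]] cl1|F1 cl1|F1 F2 F3 _ IH1 _ IH2 cl1].
- split; first exact: DP_clause_set.
  by split; [apply: MU1_DP | apply: DP_MU1].
- by split.
have [cl2 e12] := IH1 cl1; have [cl3 e23] := IH2 cl2.
by split=> //; rewrite e12.
Qed.

Lemma sDP_result_exists F : exists G, sDP_result F G.
Proof.
have [n] := ubnP #|` var F|; elim: n F => // n IH F leFn.
have [irr|] := classic (sDP_irreducible F).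
  by exists F; split=> //; apply: Relation_Operators.rt_refl.
move=> /not_all_not_ex[G stepG]; have [v [sv _ GE]] := stepG.
have [|H [GH irrH]] := IH G.
  have := fsubset_leq_card (var_DP_sub F v); rewrite -GE => leG.
  by move: leFn; rewrite (cardfsD1 v) singular_var //; lia.
exists H; split=> //; apply: Relation_Operators.rt_trans GH.
exact: Relation_Operators.rt_step.
Qed.

Lemma MU1_result_bot F G : clause_set F -> MU1 F -> sDP_result F G -> G = bot_set.
Proof.
move=> clF mF [FG irrG]; have [clG [mFG _]] := sDP_reduces_MU1 FG clF.
by apply: MU1_irreducible => //; apply: mFG.
Qed.

Lemma result_bot_MU1 F : clause_set F -> sDP_result F bot_set -> MU1 F.
Proof.
by move=> clF [FG _]; have [_ [_]] := sDP_reduces_MU1 FG clF; apply; apply: MU1_bot.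
Qed.

End RelativeSatisfiability.

Theorem theorem2p5p5 (V : choiceType) (D : V -> finType)
    (hD : forall v : V, (0 < #|D v|)%N) :
  (forall F : pre_clause_set D, clause_set F ->
     (MU1 F <-> exists2 G : pre_clause_set D, sDP_result F G & G = bot_set) /\
     (MU1 F <-> forall G : pre_clause_set D, sDP_result F G -> G = bot_set))
  /\
  (forall F : pre_clause_set D,
     (clause_set F /\ MU1 F) <->
     (exists t : tree D, tree_representation t /\
        (F = tree_clause_set t \/ literal_elimination (tree_clause_set t) F))).
Proof.
split=> [F clF|F]; last exact: MU1_tree_iff.
(* Existence of an end result keeps the universal form of the criterion from being vacuous. *)
have [G FG] := sDP_result_exists hD F; split; split=> [mF|].
- by exists G => //; apply: MU1_result_bot FG.
- by case=> H FH HE; apply: result_bot_MU1 => //; rewrite -HE.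
- by move=> H; apply: MU1_result_bot.
by move/(_ G FG) => GE; apply: result_bot_MU1 => //; rewrite -GE.
Qed.
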